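(* Let $\lambda_b>0$, $\alpha>2$, $P>0$, $N>0$, $M\ge1$, $\mu\in[1,2]$. Let $(X_{11},X_{21})$ have joint density $(2\pi\lambda_b)^2x_{11}x_{21}e^{-\pi\lambda_b x_{21}^2}$ on $0<x_{11}<x_{21}$ (zero otherwise), let $\mathbb{A}_{UE}=\{X_{11}\le M^{\frac{1}{\alpha\mu}}(N/P)^{\frac{2-\mu}{\alpha\mu}}X_{21}^{2/\mu}\}$, and for $x>0$ put $\rho(x)=\max\big(x,\,x^{\mu/2}(P/N)^{\frac{2-\mu}{2\alpha}}(1/M)^{\frac{1}{2\alpha}}\big)$. Consider the following random SINR: $X_{11}$ is distributed according to its conditional law given $\mathbb{A}_{UE}$; given $X_{11}=x_{11}$, $$\mathrm{SINR}=\frac{h_{11}x_{11}^{-\alpha}}{\sum_{i\in\Phi_b'}h_iD_i^{-\alpha}\mathbf{1}(D_i\ge\rho(x_{11}))+\frac{N}{P}},$$ where $h_{11}\sim\mathrm{Exp}(1)$, $\Phi_b'$ is an inhomogeneous Poisson point process on $\mathbb{R}^2$ whose intensity at distance $r$ from the origin is $0$ if $r<\rho(x_{11})$ and $\lambda_b\mathbb{P}[\mathbb{A}_{UE}]$ if $r\ge\rho(x_{11})$, $D_i$ are the distances of its points from the origin, the $h_i$ are i.i.d. $\mathrm{Exp}(1)$, and all are mutually independent. Then $\mathcal{R}_{SE}=\mathbb{E}[\ln(1+\mathrm{SINR})]$ equals $$\mathcal{R}_{SE}=\frac{2\pi\lambda_b}{\mathbb{P}[\mathbb{A}_{UE}]}\int_0^\infty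 x_{11}e^{-\pi\lambda_b\rho(x_{11})^2}\int_0^\infty e^{-\frac{N}{P}x_{11}^\alpha(e^\tau-1)}\,\mathcal{L}_I\big(x_{11}^\alpha(e^\tau-1);x_{11}\big)\,\mathrm{d}\tau\,\mathrm{d}x_{11},$$ where $$\mathcal{L}_I(s;x_{11})=\exp\!\Big(-\frac{2\pi\lambda_b\mathbb{P}[\mathbb{A}_{UE}]}{\alpha-2}\,s\,\big(\rho(x_{11})^2\big)^{1-\frac{\alpha}{2}}\,{}_2F_1\Big[1,1-\tfrac{2}{\alpha};2-\tfrac{2}{\alpha};-s\big(\rho(x_{11})^2\big)^{-\frac{\alpha}{2}}\Big]\Big),$$ ${}_2F_1$ is the Gauss hypergeometric function, and $\mathbb{P}[\mathbb{A}_{UE}]=\int_0^\infty 2(\pi\lambda_b)^2x_{21}e^{-\pi\lambda_b x_{21}^2}\min^2\big(x_{21},M^{\frac{1}{\alpha\mu}}(N/P)^{\frac{2-\mu}{\alpha\mu}}x_{21}^{2/\mu}\big)\mathrm{d}x_{21}$.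
   Context: This is the paper's (approximate) model of the SINR of the typical active user in a downlink cellular network with base-station density $\lambda_b$, transmit power $P$, noise power $N$, path-loss exponent $\alpha$, Rayleigh fading, and a scheduling rule based on treating interference as noise with parameters $M,\mu$; rates are in nats/s/Hz. The conditional density of $X_{11}$ given $\mathbb{A}_{UE}$ is $2\pi\lambda_b x e^{-\pi\lambda_b\rho(x)^2}/\mathbb{P}[\mathbb{A}_{UE}]$. *)

(* Defs.v *)
From mathcomp Require Import all_boot all_order all_algebra.
From mathcomp Require Import all_classical all_reals all_analysis.
Import Order.TTheory GRing.Theory Num.Def Num.Theory.
Import numFieldNormedType.Exports.
Set Implicit Arguments.
Unset Strict Implicit.
Unset Printing Implicit Defensive.
Local Open Scope classical_set_scope.
Local Open Scope ring_scope.

Section Defs.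
Context {R : realType}.
Notation mu := (@lebesgue_measure R).

Definition Gamma (x : R) : R :=
  fine (\int[mu]_(t in `]0%R, +oo[) (t `^ (x - 1) * expR (- t))%:E)%E.

(* Gauss hypergeometric function 2F1(a,b;c;z), for real parameters with
   c > b > 0 and real z < 1, given by Euler's integral representation
   (the analytic continuation of the hypergeometric series to z < 1):
   2F1(a,b;c;z) = Gamma(c)/(Gamma(b)Gamma(c-b)) *
                  int_0^1 t^(b-1) (1-t)^(c-b-1) (1-zt)^(-a) dt. *)
Definition hyp2F1 (a b c z : R) : R :=
  Gamma c / (Gamma b * Gamma (c - b)) *
  fine (\int[mu]_(t in `]0%R, 1%R[)
          (t `^ (b - 1) * (1 - t) `^ (c - b - 1) * (1 - z * t) `^ (- a))%:E)%E.

Definition pois_pmf (m : R) (k : nat) : R := expR (- m) * m ^+ k / k`!%:R.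

Definition dist0 (p : R * R) : R := Num.sqrt (p.1 ^+ 2 + p.2 ^+ 2).

Definition count_pts {T : choiceType} (Phi : set T) (A : set T) : \bar R :=
  (\esum_(i in Phi `&` A) 1)%E.

Definition is_PPP d (Om : measurableType d) d' (T : measurableType d')
    (P : probability Om R) (Phi : Om -> set T) (Lam : set T -> \bar R) :=
  (forall A, measurable A -> (Lam A < +oo)%E -> forall k : nat,
      measurable [set w | count_pts (Phi w) A = (k%:R)%:E]) /\
  (forall n (A : 'I_n -> set T) (k : 'I_n -> nat),
      (forall i, measurable (A i)) -> (forall i, (Lam (A i) < +oo)%E) ->
      (forall i j, i != j -> A i `&` A j = set0) ->
      P (\bigcap_(i in [set: 'I_n]) [set w | count_pts (Phi w) (A i) = ((k i)%:R)%:E])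
      = (\prod_(i < n) (pois_pmf (fine (Lam (A i))) (k i))%:E)%E).

Variables (lamb alpha P N M mu_ : R).

Definition thr (y : R) : R :=
  M `^ (1 / (alpha * mu_)) * (N / P) `^ ((2 - mu_) / (alpha * mu_)) * y `^ (2 / mu_).

Definition rho (x : R) : R :=
  Num.max x (x `^ (mu_ / 2) * (P / N) `^ ((2 - mu_) / (2 * alpha)) * (1 / M) `^ (1 / (2 * alpha))).

Definition joint_density (z : R * R) : R :=
  if (0 < z.1) && (z.1 < z.2) then
    (2 * pi * lamb) ^+ 2 * z.1 * z.2 * expR (- (pi * lamb * z.2 ^+ 2))
  else 0.

(* the event A_UE, as a set of values of (X11, X21) *)
Definition AUE : set (R * R) := [set z | z.1 <= thr z.2].

Definition PAUE : \bar R := (\int[mu \x mu]_(z in AUE) (joint_density z)%:E)%E.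

(* marked points: ((position in R^2), fading mark) *)
Notation T := ((R * R) * R)%type.

Definition lam_int (x r : R) : R := if r < rho x then 0 else lamb * fine PAUE.

(* intensity measure of the marked PPP given X11 = x: positions with
   intensity lam_int x |p|, marks i.i.d. Exp(1) *)
Definition Lam (x : R) (A : set T) : \bar R :=
  (\int[(mu \x mu) \x mu]_(z in A) (lam_int x (dist0 z.1) * exponential_pdf 1 z.2)%:E)%E.

Definition interf (x : R) (Phi : set T) : \bar R :=
  (\esum_(z in Phi) (z.2 * dist0 z.1 `^ (- alpha) *
                       (if rho x <= dist0 z.1 then 1 else 0))%:E)%E.

(* SINR given X11 = x (the interference is a.s. finite; value 0 otherwise) *)
Definition sinr (x h : R) (Phi : set T) : R :=
  if interf x Phi \is a fin_num then
    h * x `^ (- alpha) / (fine (interf x Phi) + N / P)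
  else 0.

Definition LI (s x : R) : R :=
  expR (- (2 * pi * lamb * fine PAUE / (alpha - 2) * s * (rho x ^+ 2) `^ (1 - alpha / 2) *
           hyp2F1 1 (1 - 2 / alpha) (2 - 2 / alpha) (- s * (rho x ^+ 2) `^ (- (alpha / 2))))).

End Defs.

(* Main.v *)
Require Import Defs.
From HB Require Import structures.
From mathcomp Require Import finmap.
From mathcomp Require Import all_boot all_order all_algebra.
From mathcomp Require Import all_classical all_reals all_analysis.
From mathcomp Require Import measurable_realfun measurable_fun_approximation.
From mathcomp Require Import ring lra.
Import Order.TTheory GRing.Theory Num.Def Num.Theory.
Import numFieldNormedType.Exports.
Local Open Scope classical_set_scope.
Local Open Scope ring_scope.
Set Implicit Arguments.
Unset Strict Implicit.
Unset Printing Implicit Defensive.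

(** Condition on the serving distance [x].  For [tau > 0] the event
    [tau <= ln (1 + SINR)] reads [I <= h / s - N / P], where [I] is the
    interference and [s = x ^ alpha * (exp tau - 1)].  When the received power
    is a simple function of the marked points, [I] is a positive combination of
    independent Poisson counts; summing over their values against the
    exponential tail of [h] gives the probability
    [exp (- s N / P - int (1 - exp (- s f)) dLambda)], and monotone
    approximation from below extends this to the actual power [f], because the
    events decrease.  The exponent is evaluated by integrating out the
    exponential mark, passing to polar coordinates, and substituting
    [t = (r / rho) ^ (- alpha)], which turns it into Euler's integral for 2F1.
    The layer-cake formula then gives the conditional mean, and Tonelli with the
    marginal density of [X11] on [A_UE] gives the rate. *)

(** The hypotheses describe the process only through its counts on sets of finite intensity: their
    measurability, their joint law on disjoint sets, and their independence of the fading. The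
    interference [I] is not known in advance to be measurable, finite or independent of [h], so its
    Laplace transform is never formed by conditioning. Everything is done with the events
    [I <= h / s - b]: for a simple power such an event is a countable disjoint union of events that
    fix the counts and put [h] in a half-line, which the hypotheses evaluate directly. Infinite
    interference lies outside these events, in agreement with the value 0 that [sinr] takes there.
    [Gamma] and [hyp2F1] are read through [fine], which is why finiteness bounds accompany the
    integral identities. Finally, the probability spaces for different values of [x] are unrelated,
    so measurability of the conditional mean in [x] has to be read off its closed form. *)

(** * Integrals on the real line *)

Section integrals.
Context {R : realType}.
Local Notation mu := (@lebesgue_measure R).

Lemma derivable_continuous (f : R -> R) x : derivable f x 1 -> {for x, continuous f}.
Proof. by move=> df; apply: differentiable_continuous; apply/derivable1_diffP. Qed.

Lemma continuous_powR (a x : R) : 0 < x -> {for x, continuous (@powR R ^~ a)}.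
Proof.
move=> x0; apply: derivable_continuous; apply: derivable_powR.
by rewrite in_itv/= x0.
Qed.

Lemma is_derive_derivable (f : R -> R) (x df : R) :
  is_derive x 1 f df -> derivable f x 1 /\ 'D_1 f x = df.
Proof. by move=> dfx; split; [exact: ex_derive | exact: derive_val]. Qed.

(** Derivability is asked at the endpoint as well, so that the one-sided continuity of [F] required
    by the fundamental theorem follows from it. *)
Lemma ge0_derivable_FTC2y (f F : R -> R) (a l : R) :
  (forall x, a <= x -> 0 <= f x) -> {in `[a, +oo[, continuous f} ->
  (forall x, a <= x -> derivable F x 1 /\ 'D_1 F x = f x) -> F x @[x --> +oo] --> l ->
  (\int[mu]_(x in `[a, +oo[) (f x)%:E = (l - F a)%:E)%E.
Proof.
move=> f0 cf dF Fl; rewrite EFinB; apply: ge0_continuous_FTC2y => //.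
- apply: continuous_in_subspaceT => x; rewrite inE/= => xa.
  exact: cf.
- by move=> x ax; have [] := dF x (ltW ax).
- apply: cvg_at_right_filter.
  by apply: derivable_continuous; have [] := dF a (lexx _).
- move=> x; rewrite in_itv/= andbT => ax.
  by have [_ <-] := dF x (ltW ax); rewrite derive1E.
Qed.

Lemma derivable_FTC2 (f F : R -> R) (a b : R) : a <= b ->
  {in `[a, b], continuous f} ->
  (forall x, a <= x <= b -> derivable F x 1 /\ 'D_1 F x = f x) ->
  (\int[mu]_(x in `[a, b]) (f x)%:E = (F b - F a)%:E)%E.
Proof.
rewrite le_eqVlt => /predU1P[<-|ab] cf dF.
  by rewrite set_itv1 integral_set1 subrr.
have cF x : a <= x <= b -> {for x, continuous F}.
  by move=> xab; apply: derivable_continuous; have [] := dF x xab.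
rewrite EFinB; apply: continuous_FTC2 => //.
- by apply: continuous_in_subspaceT => x; rewrite inE/= => xa; exact: cf.
- split.
  + move=> x; rewrite in_itv/= => /andP[ax xb].
    by have := dF x; rewrite !ltW// => /(_ isT)[].
  + by apply: cvg_at_right_filter; apply: cF; rewrite lexx ltW.
  + by apply: cvg_at_left_filter; apply: cF; rewrite lexx ltW.
- move=> x; rewrite in_itv/= => /andP[ax xb].
  by have := dF x; rewrite !ltW// => /(_ isT)[_ <-]; rewrite derive1E.
Qed.

Lemma cvg_expRN_mul (a : R) : 0 < a -> expR (- (a * x)) @[x --> +oo] --> (0 : R).
Proof.
move=> a0; apply: (@cvg_comp _ _ _ _ (fun z => expR (- z)) _ (pinfty_nbhs R)).
  exact: gt0_cvgMry.
exact: cvgr_expR.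
Qed.

Lemma integral_expRN (a u : R) : 0 < a ->
  (\int[mu]_(t in `[u, +oo[) (a * expR (- (a * t)))%:E = (expR (- (a * u)))%:E)%E.
Proof.
move=> a0.
rewrite (@ge0_derivable_FTC2y (fun t => a * expR (- (a * t))) (fun t => - expR (- (a * t))) u 0)//.
- by rewrite sub0r opprK.
- by move=> x _; rewrite mulr_ge0// ?expR_ge0// ltW.
- by move=> x _; apply: derivable_continuous; exact: ex_derive.
- move=> x _; apply: is_derive_derivable; apply: is_derive_eq.
  by rewrite /GRing.scale/=; ring.
- by rewrite -oppr0; apply: cvgN; exact: cvg_expRN_mul.
Qed.

Lemma integral_gauss_tail (a u : R) : 0 < a -> 0 <= u ->
  (\int[mu]_(t in `[u, +oo[) (2 * a * t * expR (- (a * t ^+ 2)))%:E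
   = (expR (- (a * u ^+ 2)))%:E)%E.
Proof.
move=> a0 u0.
rewrite (@ge0_derivable_FTC2y (fun t => 2 * a * t * expR (- (a * t ^+ 2)))
  (fun t => - expR (- (a * t ^+ 2))) u 0)//.
- by rewrite sub0r opprK.
- move=> x ux; rewrite mulr_ge0// ?expR_ge0// mulr_ge0//; last exact: le_trans ux.
  by rewrite mulr_ge0// ltW.
- by move=> x _; apply: derivable_continuous; exact: ex_derive.
- move=> x _; apply: is_derive_derivable; apply: is_derive_eq.
  by rewrite /GRing.scale/=; ring.
- rewrite -oppr0; apply: cvgN.
  apply: (@cvg_comp _ _ _ _ (fun z => expR (- z)) _ (pinfty_nbhs R));
    last exact: cvgr_expR.
  apply: gt0_cvgMry => //.
  apply/cvgryPge => A; near=> x.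
  have x1 : 1 <= x by near: x; exact: nbhs_pinfty_ge.
  have xA : A <= x by near: x; exact: nbhs_pinfty_ge.
  by rewrite (le_trans xA)// expr2 ler_peMl// (le_trans _ x1).
Unshelve. all: by end_near. Qed.

(** This is one minus the Laplace transform of Exp(1) at [q]: the contribution of one interferer to
    the exponent once its fading is integrated out. *)
Lemma integral_laplace_exp (q : R) : 0 <= q ->
  (\int[mu]_(t in `[0%R, +oo[) ((1 - expR (- (q * t))) * expR (- t))%:E
   = (q / (1 + q))%:E)%E.
Proof.
move=> q0; have q1 : 0 < 1 + q by rewrite ltr_pwDl.
rewrite (@ge0_derivable_FTC2y (fun t => (1 - expR (- (q * t))) * expR (- t))
  (fun t => - expR (- t) + (1 + q)^-1 * expR (- ((1 + q) * t))) 0 0)//.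
- rewrite mulr0 oppr0 expR0; congr EFin; field.
  by rewrite gt_eqF.
- move=> x x0; rewrite mulr_ge0// ?expR_ge0// subr_ge0 -expR0 ler_expR.
  by rewrite oppr_le0 mulr_ge0.
- by move=> x _; apply: derivable_continuous; exact: ex_derive.
- move=> x _; apply: is_derive_derivable; apply: is_derive_eq.
  rewrite mulrBl mul1r -expRD (_ : - (q * x) - x = - ((1 + q) * x)); last by ring.
  rewrite (_ : (1 + q)%:A = 1 + q :> R) ?[_ *: _]mulr1// /GRing.scale/=; field.
  by rewrite gt_eqF.
- rewrite -[X in _ --> X](_ : - 0 + (1 + q)^-1 * 0 = 0); last by ring.
  apply: cvgD; last by apply: cvgMl_tmp; exact: cvg_expRN_mul.
  apply: cvgN; exact: cvgr_expR.
Qed.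

Lemma integral0_id (m : R) : 0 <= m ->
  (\int[mu]_(x in `]0%R, m[) x%:E = (m ^+ 2 / 2)%:E)%E.
Proof.
move=> m0; rewrite -(@integral_itv_bndoo R 0 m EFin true false)//.
  rewrite (@derivable_FTC2 id (fun x => x ^+ 2 / 2))//.
  - by rewrite expr0n/= mul0r subr0.
  - by move=> x _; exact: cvg_id.
  - move=> x _; apply: is_derive_derivable; apply: is_derive_eq.
    by rewrite /GRing.scale/=; field.
Qed.

Lemma integral_if d (T : measurableType d) (m : {measure set T -> \bar R})
    (p : pred T) (f : T -> \bar R) :
  (\int[m]_x (if p x then f x else 0) = \int[m]_(x in [set x | p x]) f x)%E.
Proof.
rewrite [RHS]integral_mkcond; apply: eq_integral => x _; rewrite patchE.
case: ifPn => px; first by rewrite mem_set.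
by rewrite memNset//=; exact/negP.
Qed.

(** For [b < 1] the integrand is singular at 0, so the antiderivative is used on [[t / n.+1, t]] and
    monotone convergence gives the limit. *)
Lemma integral_powR (b t : R) : 0 < b -> 0 <= t ->
  (\int[mu]_(u in `]0%R, t[) (b * u `^ (b - 1))%:E = (t `^ b)%:E)%E.
Proof.
move=> b0; rewrite le_eqVlt => /predU1P[<-|t0].
  by rewrite set_itvoo0 integral_set0 powR0 ?gt_eqF.
have mf (D : set R) : measurable_fun D (fun u : R => (b * u `^ (b - 1))%:E).
  apply/measurable_EFinP; apply: measurable_funTS; exact: measurable_funM.
rewrite integral_itv_bndo_bndc//.
pose F n := `[t / n.+1%:R, t]%classic : set R.
have -> : `]0, t]%classic = \bigcup_n F n.
  apply/seteqP; split => [x /=|x [n _]]; rewrite /F/= !in_itv/=; last first.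
    by move=> /andP[tx ->]; rewrite (lt_le_trans _ tx)// divr_gt0.
  move=> /andP[x0 xt]; exists (truncn (t / x)) => //=; rewrite /F /= in_itv/= xt andbT.
  rewrite ler_pdivrMr// mulrC -ler_pdivrMr// ltW//.
  exact: truncnS_gt.
have nt n : t / n.+1%:R <= t by rewrite ler_pdivrMr// ler_peMr ?ler1n// ltW.
have F1 := @ge0_nondecreasing_set_cvg_integral _ (measurableTypeR R) R F
  (fun u : R => (b * u `^ (b - 1))%:E) mu.
apply: cvg_unique (F1 _ _ _ _) _ => //.
- move=> m n mn; apply/subsetPset => x; rewrite /F/= !in_itv/= => /andP[mx ->].
  rewrite andbT (le_trans _ mx)// ler_pM2l// lef_pV2 ?posrE//.
  by rewrite ler_nat.
- by move=> i; exact: measurable_itv.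
- by move=> i; exact: mf.
- by move=> i x _; rewrite lee_fin mulr_ge0 ?powR_ge0// ltW.
- have -> : (fun i => \int[mu]_(x in F i) (b * x `^ (b - 1))%:E)%E =
      (fun i => (t `^ b - (t / i.+1%:R) `^ b)%:E).
    apply/funext => n.
    rewrite (@derivable_FTC2 (fun u => b * u `^ (b - 1)) (@powR R ^~ b))//.
      move=> x; rewrite in_itv/= => /andP[tx _].
      have x0 : 0 < x by rewrite (lt_le_trans _ tx)// divr_gt0.
      by apply: cvgMl_tmp; exact: continuous_powR.
    move=> x /andP[tx _].
    have x0 : 0 < x by rewrite (lt_le_trans _ tx)// divr_gt0.
    by apply: is_derive_derivable; exact: is_derive1_powR.
  apply: cvg_EFin; first by near=> n.
  rewrite -[X in _ --> X]subr0; apply: cvgB; first exact: cvg_cst.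
  apply: (@cvg_comp _ _ _ (fun n => t / n.+1%:R) (@powR R ^~ b) \oo 0^'+); last exact: powR_cvg0.
  have h : t / n.+1%:R @[n --> \oo] --> (0 : R).
    by rewrite -(mulr0 t); apply: cvgMl_tmp; exact: cvg_harmonic.
  move=> A; rewrite /at_right /within/= => /h hA.
  change (\forall n \near \oo, A (t / n.+1%:R)); near=> n.
  suff : 0 < t / n.+1%:R -> A (t / n.+1%:R) by apply; rewrite divr_gt0.
  by near: n; exact: hA.
Unshelve. all: by end_near. Qed.

(** The image of Lebesgue measure under multiplication by [c], rescaled by [c], agrees with Lebesgue
    measure on half-open intervals, hence everywhere. *)
Lemma integral_scale (c : R) (g : R -> \bar R) : 0 < c ->
  measurable_fun setT g -> (forall x, (0 <= g x)%E) ->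
  (\int[mu]_x g x = c%:E * \int[mu]_x g (c * x)%R)%E.
Proof.
move=> c0 mg g0; pose f : measurableTypeR R -> measurableTypeR R := fun x : R => c * x.
have mf : measurable_fun setT f by exact: (@measurable_funM _ _ R).
have -> : (\int[mu]_x g (c * x)%R = \int[mu]_(x in f @^-1` setT) (g \o f) x)%E by [].
rewrite -(ge0_integral_pushforward mf)//.
have -> : c%:E = ((NngNum (ltW c0))%:num)%:E by [].
rewrite -ge0_integral_mscale//.
apply: eq_measure_integral => A mA _.
apply: lebesgue_measure_unique => // _ [[a b] _ <-].
transitivity (c%:E * mu (f @^-1` `]a, b]))%E => //.
have -> : f @^-1` `]a, b] = `]a / c, b / c]%classic.
  apply/seteqP; split => x /=; rewrite !in_itv/= /f.
    by rewrite ltr_pdivrMr// ler_pdivlMr// mulrC.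
  by rewrite ltr_pdivrMr// ler_pdivlMr// mulrC.
rewrite !lebesgue_measure_itv/= !lte_fin ltr_pM2r ?invr_gt0//.
case: ifPn => _; last by rewrite mule0.
by rewrite -!EFinB -EFinM -mulrBl mulrCA divff ?gt_eqF// mulr1.
Qed.

Lemma integral_even (g : R -> \bar R) :
  measurable_fun setT g -> (forall x, (0 <= g x)%E) -> (forall x, g (- x) = g x) ->
  (\int[mu]_x g x = 2%:E * \int[mu]_(x in `]0%R, +oo[) g x)%E.
Proof.
move=> mg g0 ge.
have mgD D : measurable_fun D g by exact: measurable_funTS.
have -> : setT = `]-oo, 0]%classic `|` `]0, +oo[%classic :> set R.
  by apply/esym/seteqP; split => // x _ /=; rewrite !in_itv/= andbT; case: leP; [left|right].
rewrite ge0_integral_setU//; last 2 first.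
  exact: mgD.
  by apply/disj_setPRL => x /=; rewrite !in_itv/= andbT => x0; apply/negP; rewrite -ltNge.
have -> : (\int[mu]_(x in `]-oo, 0%R]) g x = \int[mu]_(x in `]0%R, +oo[) g x)%E.
  rewrite [RHS]integral_itv_obnd_cbnd// ge0_integration_by_substitution0//.
  by apply: eq_integral => x _; rewrite ge.
by rewrite -[in LHS](mul1e (\int[mu]_(x in _) _)%E) -ge0_muleDl// -EFinD.
Qed.

Lemma tonelli_xy (f : R * R -> \bar R) :
  measurable_fun setT f -> (forall z, (0 <= f z)%E) ->
  (\int[(mu \x mu)%E]_z f z = \int[mu]_x \int[mu]_y f (x, y))%E.
Proof. by move=> mf f0; rewrite (fubini_tonelli1 (m1 := mu) (m2 := mu)). Qed.

Lemma tonelli_yx (f : R * R -> \bar R) :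
  measurable_fun setT f -> (forall z, (0 <= f z)%E) ->
  (\int[(mu \x mu)%E]_z f z = \int[mu]_y \int[mu]_x f (x, y))%E.
Proof. by move=> mf f0; rewrite (fubini_tonelli2 (m1 := mu) (m2 := mu)). Qed.

Lemma tonelli_swap (f : R * R -> \bar R) :
  measurable_fun setT f -> (forall z, (0 <= f z)%E) ->
  (\int[mu]_x \int[mu]_y f (x, y) = \int[mu]_y \int[mu]_x f (x, y))%E.
Proof. by move=> mf f0; rewrite -tonelli_xy// tonelli_yx. Qed.

Lemma measurable_integral_param d (T : measurableType d) (f : T * R -> \bar R) :
  measurable_fun setT f -> (forall z, (0 <= f z)%E) ->
  measurable_fun setT (fun x => \int[mu]_y f (x, y))%E.
Proof. by move=> mf f0; exact: (@measurable_fun_fubini_tonelli_F _ _ T _ R mu f). Qed.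

Lemma measurable_invr : measurable_fun setT (@GRing.inv R).
Proof.
have -> : [set: R] = ~` [set 0] `|` [set 0] by rewrite setUC setUv.
apply/measurable_funU => //; first exact: measurableC.
split; last exact: measurable_fun_set1.
apply: open_continuous_measurable_fun.
  by apply: closed_openC; apply: accessible_closed_set1; apply: hausdorff_accessible; exact: norm_hausdorff.
by move=> x; rewrite inE/= => /eqP x0; exact: inv_continuous.
Qed.

Lemma measurable_set_ltr d (T : measurableType d) (f : T -> R) (c : R) :
  measurable_fun setT f -> measurable [set z | f z < c].
Proof.
move=> mf; have := mf measurableT `]-oo, c[%classic (measurable_itv _).
by rewrite setTI; congr (measurable _); apply/seteqP; split => z /=; rewrite in_itv.
Qed.

End integrals.

(** * Polar coordinates and a power substitution *)

Section more_integrals.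
Context {R : realType}.
Local Notation mu := (@lebesgue_measure R).

Lemma integral_oneDsqrV : (\int[mu]_t ((1 + t ^+ 2)^-1)%:E = (@pi R)%:E)%E.
Proof.
have mf (D : set R) : measurable_fun D (fun t : R => ((1 + t ^+ 2)^-1)%:E).
  apply/measurable_EFinP; apply: measurable_funTS.
  apply: continuous_measurable_fun => x.
  have := @continuous_oneDsqrV R x; exact.
rewrite integral_even//; last 2 first.
- by move=> x; rewrite lee_fin invr_ge0 addr_ge0// sqr_ge0.
- by move=> x; rewrite sqrrN.
rewrite integral_itv_obnd_cbnd//.
have := @integral0y_oneDsqr R; rewrite /oneDsqr => ->.
by rewrite -EFinM mulrCA divff// mulr1.
Qed.

Lemma measurable_sqrtr : measurable_fun setT (@Num.sqrt R).
Proof. by apply: continuous_measurable_fun; exact: sqrt_continuous. Qed.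

Lemma measurable_dist0 : measurable_fun setT (@dist0 R).
Proof.
apply: (measurableT_comp measurable_sqrtr).
by apply: measurable_funD; apply: measurable_funX.
Qed.

Lemma measurable_pair_scale (f : R * R -> \bar R) : measurable_fun setT f ->
  forall x c : R, measurable_fun setT (fun t => f (x, c * t)).
Proof.
move=> mf x c; apply: (measurableT_comp mf (g := fun t : R => (x, c * t))).
by apply: measurable_fun_pair => //; exact: measurable_funM.
Qed.

(* Scaling [y = |x| t], Tonelli, then scaling [x] by [sqrt (1 + t ^ 2)] leaves
   [int dt / (1 + t ^ 2) = pi] as the angular factor. *)
Lemma integral_radial (F : R -> R) : measurable_fun setT F -> (forall r, 0 <= F r) ->
  (\int[(mu \x mu)%E]_p (F (dist0 p))%:E
   = (2 * pi)%:E * \int[mu]_(r in `]0%R, +oo[) (r * F r)%:E)%E.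
Proof.
move=> mF F0.
have mF2 : measurable_fun setT (fun p : R * R => (F (dist0 p))%:E).
  apply/measurable_EFinP; apply: (measurableT_comp mF).
  exact: measurable_dist0.
rewrite tonelli_xy//; last by move=> p; rewrite lee_fin.
pose q (t : R) : R := Num.sqrt (1 + t ^+ 2).
have q0 t : 0 < q t by rewrite sqrtr_gt0 ltr_pwDl// sqr_ge0.
pose K (p : R * R) : \bar R := (`|p.1| * F (`|p.1| * q p.2))%:E.
have K0 p : (0 <= K p)%E by rewrite lee_fin mulr_ge0.
have mq : measurable_fun setT q.
  apply: (measurableT_comp measurable_sqrtr).
  by apply: measurable_funD => //; apply: measurable_funX.
have mK : measurable_fun setT K.
  apply/measurable_EFinP; apply: measurable_funM.
    exact: measurableT_comp.
  apply: (measurableT_comp mF); apply: measurable_funM.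
    exact: measurableT_comp.
  exact: (measurableT_comp mq).
have -> : (\int[mu]_x \int[mu]_y (F (dist0 (x, y)))%:E =
          \int[mu]_x \int[mu]_t K (x, t))%E.
  (* The scaling of [y] by [|x|] degenerates at [x = 0], so this null point is removed on both
     sides. *)
  rewrite -(@integral_setD1 R _ 0 setT); last 2 first.
    exact: measurableD.
    apply: measurable_funTS.
    by have := measurable_integral_param mF2 (fun z => F0 (dist0 z)); exact.
  rewrite -[RHS](@integral_setD1 R _ 0 setT); last 2 first.
    exact: measurableD.
    by apply: measurable_funTS; have := measurable_integral_param mK K0; exact.
  apply: eq_integral => x; rewrite inE/= => -[_ /eqP x0].
  have x0' : 0 < `|x| by rewrite normr_gt0.
  rewrite (@integral_scale _ `|x|)//; last 2 first.
    by apply: (measurableT_comp mF2); exact: measurable_pair1.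
    by move=> y; rewrite lee_fin.
  rewrite -ge0_integralZl_EFin//; last 2 first.
    by move=> y _; rewrite lee_fin.
    exact: (measurable_pair_scale mF2 x `|x|).
  apply: eq_integral => t _; rewrite /K/= -EFinM; congr (_ * F _)%:E.
  rewrite /dist0/= exprMn real_normK ?num_real// -[X in X + _]mulr1 -mulrDr.
  by rewrite sqrtrM ?sqr_ge0// sqrtr_sqr.
rewrite (tonelli_swap mK K0).
pose k (x : R) := (`|x| * F `|x|)%:E.
have mk : measurable_fun setT k.
  apply/measurable_EFinP; apply: measurable_funM => //.
  exact: measurableT_comp.
have k0 x : (0 <= k x)%E by rewrite lee_fin mulr_ge0.
have -> : (\int[mu]_t \int[mu]_x K (x, t) =
           \int[mu]_t (((1 + t ^+ 2)^-1)%:E * \int[mu]_x k x))%E.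
  apply: eq_integral => t _.
  (* Two factors [q t] appear, one from the scaling and one from the weight [|x|]; together they
     cancel [(1 + t ^+ 2)^-1]. *)
  rewrite (@integral_scale _ (q t) k)// muleA -EFinM -ge0_integralZl_EFin//; last 2 first.
  - apply: (measurableT_comp mk (g := fun x : R => q t * x)).
    exact: measurable_funM.
  - by rewrite mulr_ge0 ?invr_ge0 ?addr_ge0 ?sqr_ge0// ltW.
  apply: eq_integral => x _; rewrite /K /k/= normrM (gtr0_norm (q0 t)) -EFinM.
  rewrite (mulrC `|x| (q t)); congr EFin; rewrite mulrA; congr (_ * _).
  rewrite mulrA -[in RHS](@sqr_sqrtr _ (1 + t ^+ 2)) ?addr_ge0 ?sqr_ge0//.
  by rewrite -/(q t); field; exact: lt0r_neq0.
rewrite ge0_integralZr//; last 3 first.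
- apply/measurable_EFinP; apply: continuous_measurable_fun => x.
  have := @continuous_oneDsqrV R x; exact.
- by move=> x _; rewrite lee_fin invr_ge0 addr_ge0// sqr_ge0.
- exact: integral_ge0.
rewrite integral_oneDsqrV integral_even//; last first.
  by move=> x; rewrite /k normrN.
rewrite muleA -EFinM (mulrC pi); congr (_ * _)%E.
by apply: eq_integral => x; rewrite inE/= in_itv/= andbT => x0; rewrite /k gtr0_norm.
Qed.

(** Serves for [derive1 F] in the substitution below, whose closed form is known only at positive
    arguments. *)
Lemma continuous_near_eq (f g : R -> R) (x : R) :
  {near x, f =1 g} -> {for x, continuous g} -> {for x, continuous f}.
Proof.
move=> fg cg; rewrite /prop_for /continuous_at (nbhs_singleton fg).
by apply: cvg_trans cg; apply: near_eq_cvg; apply: filterS fg => y ->.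
Qed.

(** The left range is unbounded and the right integrand is singular at 0. The decreasing
    substitution is therefore made on [[rho, rho * n.+1]], whose image is [[F (b n), 1]], and both
    sides are limits along these increasing intervals. *)
Lemma integral_powR_subst (rho alpha z : R) : 0 < rho -> 0 < alpha -> 0 <= z ->
  (\int[mu]_(r in `[rho, +oo[)
     (alpha * rho `^ (alpha - 2) * r `^ (1 - alpha) /
        (1 + z * (rho `^ alpha * r `^ (- alpha))))%:E =
   \int[mu]_(t in `]0%R, 1%R[) (t `^ (- (2 / alpha)) / (1 + z * t))%:E)%E.
Proof.
move=> rho0 alpha0 z0.
pose F (r : R) := rho `^ alpha * r `^ (- alpha).
pose G (t : R) := t `^ (- (2 / alpha)) / (1 + z * t).
have zt (t : R) : 0 <= t -> 0 < 1 + z * t by move=> t0; rewrite ltr_pwDl// mulr_ge0.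
have dF (r : R) : 0 < r -> is_derive r 1 F (rho `^ alpha * (- alpha * r `^ (- alpha - 1))).
  move=> r0; have ? := @is_derive1_powR R (- alpha) r r0.
  by apply: is_derive_eq.
have dFE (r : R) : 0 < r -> derive1 F r = rho `^ alpha * (- alpha * r `^ (- alpha - 1)).
  by move=> r0; have ? := dF r r0; rewrite derive1E derive_val.
have cdF (r : R) : 0 < r -> {for r, continuous (derive1 F)}.
  move=> r0; apply: (@continuous_near_eq _
    (fun r => rho `^ alpha * (- alpha * r `^ (- alpha - 1)))).
    near=> y; apply: dFE; near: y; exact: lt_nbhsr.
  by do 2 apply: cvgMl_tmp; exact: continuous_powR.
have mG (D : set R) : measurable_fun D (EFin \o G).
  apply/measurable_EFinP; apply: measurable_funTS; apply: measurable_funM => //.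
  apply: (measurableT_comp measurable_invr).
  by apply: measurable_funD => //; apply: measurable_funM.
have FE (r : R) : 0 < r -> F r = (r / rho) `^ (- alpha).
  move=> r0; rewrite powRM ?invr_ge0 ?ltW// mulrC; congr (_ * _).
  by rewrite -(powR_inv1 (ltW rho0)) -powRrM mulN1r opprK.
have Fdecr (x y : R) : 0 < x -> 0 < y -> x < y -> F y < F x.
  move=> x0 y0 xy; rewrite /F ltr_pM2l ?powR_gt0// !powRN ltf_pV2 ?posrE ?powR_gt0//.
  by apply: gt0_ltr_powR => //; rewrite nnegrE ltW.
have Frho : F rho = 1 by rewrite FE// divff ?gt_eqF// powR1.
pose b (n : nat) := rho * n.+1%:R.
have b0 n : 0 < b n by rewrite mulr_gt0.
have rb n : rho <= b n by rewrite ler_peMr ?ler1n// ltW.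
have sub n : (\int[mu]_(t in `[F (b n), F rho]) (G t)%:E =
   \int[mu]_(r in `[rho, b n]) (alpha * rho `^ (alpha - 2) * r `^ (1 - alpha) /
        (1 + z * F r))%:E)%E.
  rewrite integration_by_substitution_decreasing//.
  - apply: eq_integral => r; rewrite inE/= in_itv/= => /andP[rr _].
    have r0 : 0 < r by exact: lt_le_trans rr.
    transitivity (G (F r) * - derive1 F r)%:E => //.
    rewrite dFE// /G; congr EFin.
    (* The factor with exponent [- (2 / alpha)], taken at [F r], is the square of [r / rho]. The
       powers of [rho] and [r] are then split so that only squares and common real powers remain for
       [field]. *)
    rewrite {1}FE// -powRrM (_ : - alpha * - (2 / alpha) = 2); last first.
      by field; rewrite gt_eqF.
    have e1 : rho `^ alpha = rho `^ (alpha - 2) * rho ^+ 2.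
      by rewrite -(powR_mulrn _ (ltW rho0)) -powRD ?subrK// (gt_eqF rho0) implybT.
    have e2 : r `^ (1 - alpha) = r `^ (- alpha - 1) * r ^+ 2.
      rewrite -(powR_mulrn _ (ltW r0)) -powRD ?(gt_eqF r0) ?implybT//.
      by congr (_ `^ _); ring.
    rewrite (powR_mulrn 2) ?divr_ge0 ?ltW// e2 [in RHS]mulrAC.
    rewrite e1; field.
    by apply/andP; split; apply: lt0r_neq0 => //; apply: zt; rewrite mulr_ge0 ?powR_ge0.
  - move=> x y; rewrite !in_itv/= => /andP[rx _] /andP[ry _]; apply: Fdecr; exact: lt_le_trans rho0 _.
  - by move=> x; rewrite in_itv/= => /andP[rx _]; apply: cdF; exact: lt_trans rx.
  - by apply/cvg_ex; exists (derive1 F rho); apply: cvg_at_right_filter; exact: cdF.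
  - by apply/cvg_ex; exists (derive1 F (b n)); apply: cvg_at_left_filter; exact: cdF.
  - have cF (r : R) : 0 < r -> {for r, continuous F}.
      by move=> r0; have ? := dF r r0; apply: derivable_continuous; exact: ex_derive.
    split.
    + move=> x; rewrite in_itv/= => /andP[rx _].
      by have ? := dF x (lt_trans rho0 rx); exact: ex_derive.
    + by apply: cvg_at_right_filter; exact: cF.
    + by apply: cvg_at_left_filter; exact: cF.
  - apply: continuous_in_subspaceT => t; rewrite inE/= in_itv/= => /andP[Ft _].
    have t0 : 0 < t by apply: lt_le_trans Ft; rewrite mulr_gt0 ?powR_gt0.
    have ? := @is_derive1_powR R (- (2 / alpha)) t t0.
    have := zt t (ltW t0) => zt0.
    apply: cvgM; first exact: continuous_powR.
    apply: cvgV; first by rewrite gt_eqF.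
    by apply: cvgD; [exact: cvg_cst | apply: cvgMl_tmp; exact: cvg_id].
have sub1 n := sub n; rewrite Frho in sub1; rewrite integral_itv_bndo_bndc//.
have -> : `]0, 1]%classic = \bigcup_n `[F (b n), 1]%classic.
  apply/seteqP; split => [x /=|x [n _]/=]; rewrite !in_itv/=; last first.
    by move=> /andP[Fx ->]; rewrite andbT (lt_le_trans _ Fx)// mulr_gt0 ?powR_gt0.
  move=> /andP[x0 x1].
  (* Since [F (b n)] is [n.+1] to the power [- alpha], it is at most [x] as soon as [n.+1] exceeds
     [x] to the power [- alpha^-1]. *)
  exists (truncn (x `^ (- alpha^-1))) => //=; rewrite in_itv/= x1 andbT.
  rewrite FE// /b mulrAC divff ?gt_eqF// mul1r.
  rewrite powRN -[leRHS]invrK lef_pV2 ?posrE ?invr_gt0 ?powR_gt0//.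
  have -> : x^-1 = (x `^ (- alpha^-1)) `^ alpha.
    by rewrite -powRrM mulNr mulVf ?gt_eqF// powR_inv1// ltW.
  apply: ge0_ler_powR; rewrite ?nnegrE ?powR_ge0// ?ltW//.
  exact: truncnS_gt.
have -> : `[rho, +oo[%classic = \bigcup_n `[rho, b n]%classic.
  apply/seteqP; split => [x /=|x [n _]/=]; rewrite !in_itv/= andbT; last first.
    by move=> /andP[].
  move=> rx; exists (truncn (x / rho)) => //=; rewrite in_itv/= rx/= /b.
  by rewrite mulrC -ler_pdivrMr// ltW// truncnS_gt.
have bmono : {homo b : m n / (m <= n)%N >-> m <= n}.
  by move=> m n mn; rewrite ler_pM2l// ler_nat.
pose f r := (alpha * rho `^ (alpha - 2) * r `^ (1 - alpha) / (1 + z * F r))%:E.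
have c1 := @ge0_nondecreasing_set_cvg_integral _ (measurableTypeR R) R
    (fun n => `[rho, b n]%classic) f mu.
have c2 := @ge0_nondecreasing_set_cvg_integral _ (measurableTypeR R) R
    (fun n => `[F (b n), 1]%classic) (EFin \o G) mu.
apply: cvg_unique (c1 _ _ _ _) _ => //.
- move=> m n mn; apply/subsetPset => x/=; rewrite !in_itv/= => /andP[-> xb]/=.
  exact: le_trans xb (bmono _ _ mn).
- move=> n; apply/measurable_EFinP; apply: measurable_funTS.
  apply: (@measurable_funM _ _ R); first exact: (@measurable_funM _ _ R).
  apply: (measurableT_comp measurable_invr).
  by apply: (@measurable_funD _ _ R) => //; do 2 apply: (@measurable_funM _ _ R) => //.
- move=> n x /=; rewrite in_itv/= => /andP[rx _]; rewrite lee_fin.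
  rewrite divr_ge0 ?mulr_ge0 ?powR_ge0 ?addr_ge0 ?mulr_ge0 ?powR_ge0//.
  exact: ltW.
rewrite /= (_ : (fun i => _) =
    (fun n => \int[mu]_(t in `[F (b n), 1%R]) (G t)%:E)%E); last first.
  by apply/funext => n; rewrite sub1.
apply: c2.
- move=> m n mn; apply/subsetPset => x/=; rewrite !in_itv/= => /andP[xb ->].
  rewrite andbT (le_trans _ xb)//.
  have [bmn|bnm] := ltP (b m) (b n); first by rewrite ltW// Fdecr.
  by have -> // : b n = b m by apply/eqP; rewrite eq_le bnm bmono.
- by move=> n; exact: measurable_itv.
- by move=> n; exact: mG.
- move=> n x /=; rewrite in_itv/= => /andP[Fx _]; rewrite lee_fin.
  have x0 : 0 <= x by apply: le_trans Fx; rewrite mulr_ge0 ?powR_ge0.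
  by rewrite divr_ge0 ?powR_ge0// addr_ge0// mulr_ge0.
Unshelve. all: by end_near. Qed.

End more_integrals.

(** * Euler's Gamma and hypergeometric integrals *)

Section gamma_hypergeometric.
Context {R : realType}.
Local Notation mu := (@lebesgue_measure R).

Lemma integral_itv0y_if (f : R -> \bar R) :
  (\int[mu]_(x in `]0%R, +oo[) f x = \int[mu]_x (if (0 < x)%R then f x else 0))%E.
Proof.
rewrite integral_if; congr (integral _ _ _); apply/seteqP.
by split => x/=; rewrite in_itv/= andbT.
Qed.

(* Tonelli applied to [t ^ b = int_0^t b u ^ (b - 1) du], instead of an improper
   integration by parts. *)
Lemma integral_GammaS (b : R) : 0 < b ->
  (\int[mu]_(t in `]0%R, +oo[) (t `^ b * expR (- t))%:E =
   b%:E * \int[mu]_(t in `]0%R, +oo[) (t `^ (b - 1) * expR (- t))%:E)%E.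
Proof.
move=> b0.
have b0' := ltW b0.
pose f (z : R * R) : \bar R := if (0 < z.2) && (z.2 < z.1)
  then (b * z.2 `^ (b - 1) * expR (- z.1))%:E else 0%E.
have f0 z : (0 <= f z)%E.
  by rewrite /f; case: ifP => // _; rewrite lee_fin !mulr_ge0 ?powR_ge0 ?expR_ge0.
have mf : measurable_fun setT f.
  apply: measurable_fun_ifT => //.
    by apply: measurable_and; apply: measurable_fun_ltr.
  apply/measurable_EFinP; apply: measurable_funM.
    by apply: measurable_funM => //; exact: (measurableT_comp (@measurable_powR R (b - 1))).
  by apply: (measurableT_comp (@measurable_expR R)); apply: measurableT_comp.
transitivity (\int[mu]_t \int[mu]_u f (t, u))%E.
  rewrite integral_itv0y_if; apply: eq_integral => t _.
  have [t0|t0] := ltP 0 t; last first.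
    rewrite integral0_eq// => u _; rewrite /f/= ifF//.
    by apply/negP => /andP[u0 /(lt_trans u0)]; rewrite ltNge t0.
  rewrite /f/= integral_if.
  rewrite [X in integral _ X _](_ : _ = `]0, t[%classic); last first.
    by apply/seteqP; split => x/=; rewrite in_itv.
  rewrite EFinM -(integral_powR b0 (ltW t0)).
  rewrite -ge0_integralZr//; last 2 first.
    by apply/measurable_EFinP; apply: measurable_funTS; apply: (@measurable_funM _ _ R).
    by move=> x _; rewrite lee_fin mulr_ge0// powR_ge0.
rewrite tonelli_swap//.
rewrite -ge0_integralZl_EFin//; last 2 first.
- by move=> x _; rewrite lee_fin mulr_ge0 ?powR_ge0 ?expR_ge0.
- apply/measurable_EFinP; apply: measurable_funTS; apply: (@measurable_funM _ _ R) => //.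
  by apply: (measurableT_comp (@measurable_expR R)).
rewrite integral_itv0y_if; apply: eq_integral => u _; rewrite /f/=.
have [u0|u0] /= := ltP 0 u; last exact: integral0.
rewrite integral_if.
rewrite [X in integral _ X _](_ : _ = `]u, +oo[%classic); last first.
  by apply/seteqP; split => x/=; rewrite in_itv/= andbT.
under eq_integral do rewrite EFinM.
have me : measurable_fun setT (fun t : R => (expR (- t))%:E).
  by apply/measurable_EFinP; apply: (measurableT_comp (@measurable_expR R)).
rewrite ge0_integralZl_EFin//; last 2 first.
- exact: measurable_funTS.
- by rewrite mulr_ge0// powR_ge0.
rewrite integral_itv_obnd_cbnd//; last exact: measurable_funTS.
have := @integral_expRN R 1 u ltr01.
under eq_integral do rewrite !mul1r.
by rewrite mul1r => ->; rewrite -!EFinM mulrA.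
Qed.

Lemma integral_Gamma1 : (\int[mu]_(t in `]0%R, +oo[) (t `^ (1 - 1) * expR (- t))%:E = 1)%E.
Proof.
rewrite subrr; under eq_integral do rewrite powRr0 mul1r.
rewrite integral_itv_obnd_cbnd; last first.
  by apply: measurable_funTS; apply/measurable_EFinP; apply: (measurableT_comp (@measurable_expR R)).
have := @integral_expRN R 1 0 ltr01.
under eq_integral do rewrite !mul1r.
by rewrite mulr0 oppr0 expR0.
Qed.

(** With the recurrence, these bounds make the integral for [Gamma b] finite and nonzero, so that
    the quotient of the two Gamma values can be simplified to [b]. Below, the power is at least 1 on
    [[1, +oo[], which leaves an exponential tail. Above, the power is at most [1 + t], hence at most
    [2 * expR (t / 2)], and the integral of [2 * expR (- t / 2)] is 4. *)
Lemma integral_GammaS_bounds (b : R) : 0 < b <= 1 ->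
  ((expR (- 1))%:E <= \int[mu]_(t in `]0%R, +oo[) (t `^ b * expR (- t))%:E <= 4%:E)%E.
Proof.
move=> /andP[b0 b1].
have mg : measurable_fun setT (fun t : R => (t `^ b * expR (- t))%:E).
  apply/measurable_EFinP; apply: measurable_funM => //.
  exact: (measurableT_comp (@measurable_expR R)).
have me c : measurable_fun setT (fun t : R => (c * expR (- (c * t)))%:E).
  apply/measurable_EFinP; apply: measurable_funM => //.
  apply: (measurableT_comp (@measurable_expR R)).
  by apply: measurableT_comp => //; apply: measurable_funM.
apply/andP; split.
  have := @integral_expRN R 1 1 ltr01; rewrite mul1r => <-.
  apply: (@le_trans _ _ (\int[mu]_(t in `[1%R, +oo[) (t `^ b * expR (- t))%:E)%E).
    apply: ge0_le_integral => //.
    - exact: measurable_funTS (me 1).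
    - exact: measurable_funTS.
    - move=> x /=; rewrite in_itv/= andbT => x1; rewrite lee_fin !mul1r.
      rewrite ler_peMl ?expR_ge0// -(powRr0 x); apply: ler_powR => //; exact: ltW.
  apply: ge0_subset_integral => //=.
  - exact: measurable_funTS.
  - by move=> x _; rewrite lee_fin mulr_ge0 ?powR_ge0 ?expR_ge0.
  - by move=> x /=; rewrite !in_itv/= !andbT; exact: lt_le_trans.
have h0 : 0 < 2^-1 :> R by rewrite invr_gt0.
have i2 := integral_expRN 0 h0.
apply: (@le_trans _ _ (\int[mu]_(t in `]0%R, +oo[) (4%:E * (2^-1 * expR (- (2^-1 * t)))%:E))%E).
  apply: ge0_le_integral => //.
  - by move=> x _; rewrite lee_fin mulr_ge0 ?powR_ge0 ?expR_ge0.
  - exact: measurable_funTS.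
  - apply: measurable_funTS; apply: emeasurable_funM => //; exact: me.
  - move=> x /=; rewrite in_itv/= andbT => x0; rewrite -EFinM lee_fin.
    rewrite mulrA (_ : 4 * 2^-1 = 2); last by field.
    rewrite (_ : - x = - (2^-1 * x) - (2^-1 * x)); last by field.
    rewrite expRD mulrA ler_wpM2r ?expR_ge0//.
    rewrite -ler_pdivlMr ?expR_gt0// -expRN opprK.
    have h1 : 1 + 2^-1 * x <= expR (2^-1 * x) by exact: expR_ge1Dx.
    have h2 : x `^ b <= 1 + x.
      have [x1|x1] := leP x 1.
        apply: (@le_trans _ _ 1); last by rewrite lerDl ltW.
        by rewrite -(powRr0 x); apply: ger_powR; [rewrite x0 | exact: ltW].
      apply: (@le_trans _ _ x); last by rewrite lerDr.
      by rewrite -{2}(powRr1 (ltW x0)); apply: ler_powR => //; exact: ltW.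
    rewrite (le_trans h2)//.
    by have : 0 < 2^-1 * x; [rewrite mulr_gt0|]; lra.
rewrite ge0_integralZl//; last first.
  by apply: measurable_funTS; exact: (me 2^-1).
rewrite integral_itv_obnd_cbnd; last exact: measurable_funTS (me 2^-1).
by rewrite i2 mulr0 oppr0 expR0 mule1.
Qed.

(** For [c = b + 1] the factor in [1 - t] has exponent 0 and [Gamma (c - b)] is 1, so Euler's
    prefactor reduces to [b]. The sign of [z] keeps [1 - z * t] nonnegative, which lets the power
    [- 1] be read as an inverse. *)
Lemma hyp2F1_1 (b c z : R) : 0 < b <= 1 -> c = b + 1 -> z <= 0 ->
  hyp2F1 1 b c z =
  b * fine (\int[mu]_(t in `]0%R, 1%R[) (t `^ (b - 1) / (1 - z * t))%:E)%E.
Proof.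
move=> b01 cb z0; rewrite /hyp2F1.
have -> : Gamma (c - b) = 1 by rewrite cb addrAC subrr add0r /Gamma integral_Gamma1.
have /andP[b0 _] := b01.
have -> : Gamma c / (Gamma b * 1) = b.
  have := integral_GammaS_bounds b01; have := integral_GammaS b0.
  rewrite mulr1 /Gamma cb addrK.
  set I := (\int[_]_(_ in _) _)%E; set J := (\int[_]_(_ in _) _)%E => IJ /andP[I1 I4].
  have J0 : (0 <= J)%E.
    by apply: integral_ge0 => x _; rewrite lee_fin mulr_ge0 ?powR_ge0 ?expR_ge0.
  have Jfin : J \is a fin_num.
    rewrite ge0_fin_numE// ltNge; apply/negP; rewrite leye_eq => /eqP Jy.
    by move: I4; rewrite IJ Jy mulry gtr0_sg// mul1e.
  rewrite IJ fineM// /= mulfK//.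
  apply/eqP => J00; move: I1; rewrite IJ -(fineK Jfin) J00 mule0 lee_fin.
  by rewrite leNgt expR_gt0.
congr (_ * fine _); apply: eq_integral => t; rewrite inE/= in_itv/= => /andP[t0 t1].
have zt : 0 <= 1 - z * t.
  by rewrite subr_ge0 (@le_trans _ _ 0)// mulr_le0_ge0// ltW.
by rewrite powR_inv1// (_ : c - b - 1 = 0) ?powRr0 ?mulr1// cb; ring.
Qed.

(** The substitution produces Euler's integral with [b = 1 - 2 / alpha] and [c = b + 1]; [2 < alpha]
    is what makes [b] positive. *)
Lemma integral_interference (rho alpha s : R) : 0 < rho -> 2 < alpha -> 0 <= s ->
  (\int[mu]_(r in `[rho, +oo[) (r * (s * r `^ (- alpha) / (1 + s * r `^ (- alpha))))%:E
   = ((alpha - 2)^-1 * s * (rho ^+ 2) `^ (1 - alpha / 2) *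
      hyp2F1 1 (1 - 2 / alpha) (2 - 2 / alpha) (- s * (rho ^+ 2) `^ (- (alpha / 2))))%:E)%E.
Proof.
move=> rho0 alpha2 s0.
have a0 : 0 < alpha by rewrite (lt_trans _ alpha2).
have an0 : alpha != 0 by rewrite gt_eqF.
have b0 : 0 < 1 - 2 / alpha by rewrite subr_gt0 ltr_pdivrMr// mul1r.
have b1 : 1 - 2 / alpha <= 1 by rewrite gerBl divr_ge0// ltW.
have r2 x : (rho ^+ 2) `^ x = rho `^ (2 * x).
  by rewrite -(powR_mulrn 2 (ltW rho0)) -powRrM.
rewrite !r2 mulrBr mulr1 mulrN (_ : 2 * (alpha / 2) = alpha); last by field.
set z := s * rho `^ (- alpha).
have z0 : 0 <= z by rewrite mulr_ge0// powR_ge0.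
rewrite hyp2F1_1; last 3 first.
- by rewrite b0.
- by ring.
- by rewrite mulNr oppr_le0.
rewrite (_ : 1 - 2 / alpha - 1 = - (2 / alpha)); last by ring.
pose J := (\int[mu]_(t in `]0%R, 1%R[) (t `^ (- (2 / alpha)) / (1 + z * t))%:E)%E.
have -> : (\int[mu]_(t in `]0%R, 1%R[) (t `^ (- (2 / alpha)) / (1 - - s * rho `^ (- alpha) * t))%:E)%E = J.
  by apply: eq_integral => t _; rewrite mulNr mulNr opprK.
have mJ : measurable_fun setT (fun t : R => (t `^ (- (2 / alpha)) / (1 + z * t))%:E).
  apply/measurable_EFinP; apply: measurable_funM => //.
  apply: (measurableT_comp measurable_invr).
  by apply: measurable_funD => //; apply: measurable_funM.
have J0 : (0 <= J)%E.
  apply: integral_ge0 => t /=; rewrite in_itv/= => /andP[t0 _].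
  by rewrite lee_fin divr_ge0 ?powR_ge0// addr_ge0// mulr_ge0// ltW.
(* [hyp2F1] takes [fine] of this integral, so its finiteness must be known. The denominator is at
   least 1, and the remaining power is integrable at 0 because [2 / alpha < 1]. *)
have Jfin : J \is a fin_num.
  rewrite ge0_fin_numE//.
  apply: (@le_lt_trans _ _ (((1 - 2 / alpha)^-1)%:E *
     \int[mu]_(t in `]0%R, 1%R[) ((1 - 2 / alpha) * t `^ ((1 - 2 / alpha) - 1))%:E)%E); last first.
    by rewrite integral_powR// -EFinM ltry.
  rewrite -ge0_integralZl_EFin//; last 3 first.
  - by move=> t _; rewrite lee_fin mulr_ge0 ?powR_ge0// ltW.
  - by apply/measurable_EFinP; apply: measurable_funTS; apply: (@measurable_funM _ _ R).
  - by rewrite invr_ge0 ltW.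
  apply: ge0_le_integral => //.
  - move=> t /=; rewrite in_itv/= => /andP[t0 _].
    by rewrite lee_fin divr_ge0 ?powR_ge0// addr_ge0// mulr_ge0// ltW.
  - exact: measurable_funTS.
  - apply/measurable_EFinP; apply: measurable_funTS.
    by do 2 apply: (@measurable_funM _ _ R) => //.
  - move=> t /=; rewrite in_itv/= => /andP[t0 _]; rewrite -EFinM lee_fin mulrA mulVf ?gt_eqF// mul1r.
    rewrite (_ : 1 - 2 / alpha - 1 = - (2 / alpha)); last by ring.
    have d1 : 1 <= 1 + z * t by rewrite lerDl mulr_ge0// ltW.
    by rewrite ler_piMr ?powR_ge0// invf_le1// (lt_le_trans _ d1).
(* Euler's prefactor [1 - 2 / alpha] divided by [alpha - 2] is [1 / alpha], which cancels the
   [alpha] in the substituted integrand. *)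
transitivity ((s * rho `^ (2 - alpha) / alpha)%:E * J)%E; last first.
  rewrite -[in LHS](fineK Jfin) -EFinM; congr EFin; field.
  by rewrite an0 subr_eq0 gt_eqF.
rewrite /J -(integral_powR_subst rho0 a0 z0)// -ge0_integralZl_EFin//; last 3 first.
- move=> r /=; rewrite in_itv/= andbT => rr; rewrite lee_fin.
  by rewrite divr_ge0 ?mulr_ge0 ?powR_ge0 ?addr_ge0 ?mulr_ge0 ?powR_ge0// ltW.
- apply/measurable_EFinP; apply: measurable_funTS.
  apply: (@measurable_funM _ _ R); first by apply: (@measurable_funM _ _ R).
  apply: (measurableT_comp measurable_invr).
  by apply: (@measurable_funD _ _ R) => //; do 2 apply: (@measurable_funM _ _ R) => //.
- by rewrite divr_ge0 ?mulr_ge0 ?powR_ge0// ltW.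
apply: eq_integral => r; rewrite inE/= in_itv/= andbT => rr.
have r0 : 0 < r by exact: lt_le_trans rr.
rewrite -EFinM; congr EFin.
have -> : z * (rho `^ alpha * r `^ (- alpha)) = s * r `^ (- alpha).
  by rewrite /z powRN; field; rewrite gt_eqF// powR_gt0.
have -> : r `^ (1 - alpha) = r * r `^ (- alpha).
  by rewrite powRD ?(gt_eqF r0) ?implybT// powRr1// ltW.
have e : rho `^ (2 - alpha) * rho `^ (alpha - 2) = 1.
  rewrite -powRD ?(gt_eqF rho0) ?implybT//.
  by rewrite (_ : 2 - alpha + (alpha - 2) = 0) ?powRr0//; ring.
have d0 : 1 + s * r `^ (- alpha) != 0.
  by rewrite gt_eqF// ltr_pwDl// mulr_ge0// powR_ge0.
transitivity (rho `^ (2 - alpha) * rho `^ (alpha - 2) *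
  (r * (s * r `^ (- alpha) / (1 + s * r `^ (- alpha))))); first by rewrite e mul1r.
by field; rewrite an0 d0.
Qed.

End gamma_hypergeometric.

(** * Poisson counts *)

Section poisson.
Context {R : realType}.
Local Open Scope ereal_scope.

(** The generating function of the Poisson law, obtained from the exponential series in [m * q]. *)
Lemma nneseries_pois_pmf (m q : R) : (0 <= m)%R -> (0 <= q)%R ->
  \sum_(0 <= j <oo) (pois_pmf m j * q ^+ j)%:E = (expR (- (m * (1 - q))))%:E.
Proof.
move=> m0 q0; apply/cvg_lim => //.
have -> : (fun n => \sum_(0 <= j < n) (pois_pmf m j * q ^+ j)%:E) =
    (fun n => (expR (- m) * series (exp_coeff (m * q)) n)%:E).
  apply/funext => n; rewrite sumEFin /series/= mulr_sumr; congr EFin.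
  apply: eq_bigr => j _; rewrite /pois_pmf /exp_coeff/= exprMn.
  by ring.
apply: cvg_EFin; first by near=> n.
rewrite [X in _ --> X](_ : _ = expR (- m) * expR (m * q))%R; last first.
  by rewrite -expRD; congr expR; ring.
apply: cvgMl_tmp; exact: is_cvg_series_exp_coeff.
Unshelve. all: by end_near. Qed.

Lemma pois_pmf_ge0 (m : R) k : (0 <= m)%R -> (0 <= pois_pmf m k)%R.
Proof. by move=> m0; rewrite /pois_pmf !mulr_ge0// ?expR_ge0 ?exprn_ge0. Qed.

(* Induction on the number of counts: the value of the first one is summed out and
   absorbed into the threshold [t] and the factor [a]. *)
Lemma probability_poisson_mixture d (Om : measurableType d) (P : probability Om R) n :
  forall (N : 'I_n -> Om -> \bar R) (c m : 'I_n -> R) (F : R -> set Om) (a : R),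
  (0 <= a)%R -> (forall i, 0 <= c i)%R -> (forall i, 0 <= m i)%R ->
  (forall t, measurable (F t)) ->
  (forall i (k : nat), measurable [set w | N i w = k%:R%:E]) ->
  (forall t (k : 'I_n -> nat), (0 <= t)%R ->
    P (F t `&` \bigcap_(i in [set: 'I_n]) [set w | N i w = (k i)%:R%:E]) =
    (a * expR (- t) * \prod_(i < n) pois_pmf (m i) (k i))%:E) ->
  forall t, (0 <= t)%R ->
  let E := [set w | exists k : 'I_n -> nat,
        (forall i, N i w = (k i)%:R%:E) /\ F (t + \sum_(i < n) c i * (k i)%:R)%R w] in
  measurable E /\
  P E = (a * expR (- t) * \prod_(i < n) expR (- (m i * (1 - expR (- c i)))))%:E.
Proof.
elim: n => [|n IHn] N c m F a a0 c0 m0 mF mN PF t t0 E.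
  have -> : E = F t.
    apply/seteqP; split => w /=.
      by move=> [k [_]]; rewrite big_ord0 addr0.
    move=> Ftw; exists (fun=> 0%N); rewrite big_ord0 addr0; split => //.
    by case.
  split; first exact: mF.
  have := PF t (fun=> 0%N) t0; rewrite !big_ord0 => <-.
  by congr (P _); rewrite (_ : \bigcap_(i in _) _ = setT) ?setIT//; apply/seteqP; split => // w _ [].
pose N' (i : 'I_n) := N (lift ord0 i).
pose c' (i : 'I_n) := c (lift ord0 i).
pose m' (i : 'I_n) := m (lift ord0 i).
(* The event on the first count is absorbed into [F]. This is why the lemma takes an arbitrary
   family [F] rather than the half-line events of [h]. *)
pose Fj j (s : R) := F s `&` [set w | N ord0 w = j%:R%:E].
pose tj (j : nat) : R := (t + c ord0 * j%:R)%R.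
have tj0 j : (0 <= tj j)%R by rewrite addr_ge0// mulr_ge0.
pose Ej j := [set w | exists k : 'I_n -> nat,
   (forall i, N' i w = (k i)%:R%:E) /\ Fj j (tj j + \sum_(i < n) c' i * (k i)%:R)%R w].
have IHj j : measurable (Ej j) /\ P (Ej j) =
   (a * pois_pmf (m ord0) j * expR (- tj j) *
      \prod_(i < n) expR (- (m' i * (1 - expR (- c' i)))))%:E.
  apply: (IHn N' c' m' (Fj j) (a * pois_pmf (m ord0) j)%R) => //.
  - by rewrite mulr_ge0// pois_pmf_ge0.
  - by move=> i; exact: c0.
  - by move=> i; exact: m0.
  - by move=> s; apply: measurableI => //; exact: mN.
  - by move=> i k; exact: mN.
  move=> s k s0.
  pose k' (i : 'I_n.+1) := if unlift ord0 i is Some i' then k i' else j.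
  have k'0 : k' ord0 = j by rewrite /k' unlift_none.
  have k'S i : k' (lift ord0 i) = k i by rewrite /k' liftK.
  have := PF s k' s0; rewrite big_ord_recl k'0.
  under eq_bigr do rewrite k'S.
  rewrite mulrA (mulrAC a) => <-; congr (P _).
  rewrite /Fj -setIA; congr (_ `&` _); apply/seteqP; split => w /=.
    move=> [N0 NS] i _ /=; case: (unliftP ord0 i) => [i' ->|->]; last by rewrite k'0.
    by rewrite k'S; exact: NS.
  move=> H; split; first by have := H ord0 I; rewrite /= k'0.
  by move=> i _; have := H (lift ord0 i) I; rewrite /= k'S.
have EE : E = \bigcup_j Ej j.
  apply/seteqP; split => w /=.
    move=> [k [Nk Fw]]; exists (k ord0) => //; exists (fun i => k (lift ord0 i)).
    split; first by move=> i; exact: Nk.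
    split; last exact: Nk.
    by move: Fw; rewrite big_ord_recl addrA.
  move=> [j _ [k [Nk [Fw N0]]]].
  exists (fun i => if unlift ord0 i is Some i' then k i' else j); split.
    move=> i; case: (unliftP ord0 i) => [i' ->|->]; last exact: N0.
    exact: Nk.
  rewrite big_ord_recl unlift_none addrA.
  by under eq_bigr do rewrite liftK.
have tEj : trivIset setT Ej.
  apply/trivIsetP => i j _ _ ij; apply/seteqP; split => // w [] /=.
  move=> [k [_ [_ /= Ni]]] [k' [_ [_ /= Nj]]].
  move: Ni; rewrite Nj => -[] /eqP; rewrite eqr_nat => /eqP ji.
  by rewrite ji eqxx in ij.
have mE : measurable E by rewrite EE; apply: bigcup_measurable => j _; have [] := IHj j.
split => //.
rewrite EE measure_bigcup//=; last by move=> j _; have [] := IHj j.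
(* The shift of the threshold by [c ord0 * j] contributes [expR (- c ord0) ^+ j], so the sum over
   [j] is the Poisson generating function at [expR (- c ord0)]. *)
rewrite (eq_eseriesr (g := fun j => (a * expR (- t) *
   \prod_(i < n) expR (- (m' i * (1 - expR (- c' i)))))%:E *
   (pois_pmf (m ord0) j * expR (- c ord0) ^+ j)%:E)); last first.
  move=> j _; have [_ ->] := IHj j; rewrite -EFinM; congr EFin.
  rewrite /tj opprD expRD -expRM_natr mulNr; ring.
rewrite nneseriesZl; last first.
  by move=> j _; rewrite lee_fin mulr_ge0 ?pois_pmf_ge0 ?exprn_ge0 ?expR_ge0.
rewrite (@eq_eseriesl _ _ xpredT); last by move=> j; rewrite in_setT.
rewrite nneseries_pois_pmf ?expR_ge0// -EFinM; congr EFin.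
by rewrite big_ord_recl /m' /c'; ring.
Qed.

Lemma count_pts_nat_or_pinfty (T : choiceType) (Phi A : set T) :
  (exists k : nat, @count_pts R _ Phi A = k%:R%:E) \/ @count_pts R _ Phi A = +oo.
Proof.
rewrite /count_pts; have [fin|inf] := pselect (finite_set (Phi `&` A)).
  left; exists (size (finmap.enum_fset (fset_set (Phi `&` A)))).
  rewrite esum_fset// fsbig_finite//= sumEFin big_const_seq count_predT.
  by rewrite iter_addr_0.
right; apply/eqyP => r r0.
have [B BP sB] := infinite_set_fset (truncn r).+1 inf.
apply: esum_ge; exists [set` B]; first by split => //; exact: finite_fset.
rewrite fsbig_finite//= set_fsetK sumEFin big_const_seq count_predT iter_addr_0.
rewrite lee_fin (le_trans (ltW (truncnS_gt r)))// ler_nat.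
exact: sB.
Qed.

(** The assumption speaks of finite values only. A count is a natural number or [+oo], so the event
    that it is infinite is the complement of a countable union of measurable events. *)
Lemma measurable_count_pts d (Om : measurableType d) (T : choiceType)
    (Phi : Om -> set T) (A : set T) :
  (forall k : nat, measurable [set w | @count_pts R _ (Phi w) A = k%:R%:E]) ->
  measurable_fun setT (fun w => @count_pts R _ (Phi w) A).
Proof.
move=> mk _ B mB; rewrite setTI.
pose U := \bigcup_(k in [set k : nat | B k%:R%:E]) [set w | @count_pts R _ (Phi w) A = k%:R%:E].
pose V := if pselect (B +oo) then ~` \bigcup_k [set w | @count_pts R _ (Phi w) A = k%:R%:E] else set0.
have -> : (fun w => @count_pts R _ (Phi w) A) @^-1` B = U `|` V.
  apply/seteqP; split => w /=.
    have [[k kE] Bw|E] := count_pts_nat_or_pinfty (Phi w) A; last rewrite E.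
      by left; exists k => //=; rewrite -kE.
    move=> By; right; rewrite /V; case: pselect => // _ -[k _] /= kE.
    by move: kE; rewrite E.
  move=> [[k /= Bk ->]//|].
  rewrite /V; case: pselect => //= By nk.
  have [[k kE]|->//] := count_pts_nat_or_pinfty (Phi w) A.
  by exfalso; apply: nk; exists k.
apply: measurableU.
  by apply: bigcup_measurable => k _; exact: mk.
rewrite /V; case: pselect => [By|nBy]; last exact: measurable0.
by apply: measurableC; apply: bigcup_measurable => k _; exact: mk.
Qed.

Lemma esum_indic (T : choiceType) (Phi A : set T) :
  \esum_(z in Phi) (\1_A z)%:E = @count_pts R _ Phi A.
Proof.
rewrite /count_pts esum_mkcondr; apply: eq_esum => z _.
by rewrite indicE; case: (z \in A).
Qed.

Lemma ge0_esumZl (T : choiceType) (Phi : set T) (c : R) (f : T -> \bar R) :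
  (0 <= c)%R -> (forall z, 0 <= f z) ->
  \esum_(z in Phi) (c%:E * f z) = c%:E * \esum_(z in Phi) f z.
Proof.
move=> + f0.
(* One inequality for all scalars suffices: the converse is this one applied to [c^-1] and the
   scaled function. *)
have le (a : R) (g : T -> \bar R) : (0 <= a)%R -> (forall z, 0 <= g z) ->
    \esum_(z in Phi) (a%:E * g z) <= a%:E * \esum_(z in Phi) g z.
  move=> a0 g0; apply: ub_ereal_sup => _ /= [A [finA AP] <-].
  rewrite -ge0_mule_fsumr//; apply: lee_wpmul2l => //.
  by apply: ereal_sup_ubound; exists A.
rewrite le_eqVlt => /predU1P[<-|c0].
  by rewrite mul0e esum1// => z _; rewrite mul0e.
apply/eqP; rewrite eq_le le//= ?(ltW c0)//.
rewrite -lee_pdivlMl//.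
apply: le_trans (le c^-1%R _ _ _).
- apply: le_esum => z _; rewrite muleA -EFinM mulVf ?gt_eqF// mul1e.
  exact: lexx.
- by rewrite invr_ge0 ltW.
- by move=> z; rewrite mule_ge0// lee_fin ltW.
Qed.

Lemma esum_simple (T : choiceType) (Phi : set T) n (c : 'I_n -> R) (A : 'I_n -> set T) :
  (forall i, 0 <= c i)%R ->
  \esum_(z in Phi) (\sum_(i < n) c i * \1_(A i) z)%:E =
  \sum_(i < n) (c i)%:E * @count_pts R _ Phi (A i).
Proof.
move=> c0.
under eq_esum do rewrite -sumEFin.
rewrite esum_sum; last by move=> z i _ _; rewrite lee_fin mulr_ge0.
apply: eq_bigr => i _; rewrite -esum_indic.
by rewrite -ge0_esumZl.
Qed.

(** An [esum] is a supremum of finite sums, and each finite sum passes to the limit under the common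
    bound [x]. *)
Lemma esum_le_of_cvg (T : choiceType) (Phi : set T) (f : (T -> R)^nat) (g : T -> R) :
  (forall z, f ^~ z @ \oo --> g z) ->
  forall x : \bar R, (forall n, \esum_(z in Phi) (f n z)%:E <= x) ->
  \esum_(z in Phi) (g z)%:E <= x.
Proof.
move=> fcvg x Hx.
apply: ub_ereal_sup => _ /= [A [finA AP] <-].
have : (fun n => \sum_(z \in A) (f n z)%:E) @ \oo --> \sum_(z \in A) (g z)%:E.
  under eq_fun do rewrite fsumEFin//.
  rewrite fsumEFin//; apply: cvg_EFin; first by near=> n.
  rewrite fsbig_finite//=.
  under eq_fun do rewrite fsbig_finite//=.
  rewrite /comp/=; elim: (finmap.enum_fset _) => [|z l IH].
    by rewrite big_nil; under eq_fun do rewrite big_nil; exact: cvg_cst.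
  rewrite big_cons.
  have -> : (fun n => \sum_(y <- z :: l) f n y)%R =
      (fun n => f n z + \sum_(y <- l) f n y)%R.
    by apply/funext => n; rewrite big_cons.
  by apply: cvgD => //; exact: fcvg.
move=> h; rewrite -(cvg_lim (@ereal_hausdorff R) h); apply: lime_le.
  by apply/cvg_ex; exists (\sum_(z \in A) (g z)%:E).
near=> n; apply: le_trans (Hx n); apply: ereal_sup_ubound.
by exists A.
Unshelve. all: by end_near. Qed.

End poisson.

(** * The exponential functional of a Poisson process *)

Section poisson_functional.
Context {R : realType}.
Local Open Scope ereal_scope.
Import HBNNSimple.

(** The pieces are the level sets of the nonzero values of [g], cut by [B]. The cut gives them
    finite intensity when [B] has it; positive coefficients ensure that an infinite count on a piece
    makes the weighted sum infinite. *)
Lemma nnsfun_disjoint_decomp d (T : measurableType d) (g : {nnsfun T >-> R}) (B : set T) :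
  measurable B ->
  exists m (c : 'I_m -> R) (A : 'I_m -> set T),
    [/\ (forall i, 0 < c i)%R, (forall i, measurable (A i)),
       (forall i, A i `<=` B), (forall i j, i != j -> A i `&` A j = set0) &
       forall z, (g z * \1_B z = \sum_(i < m) c i * \1_(A i) z)%R].
Proof.
move=> mB.
pose s := [seq y <- finmap.enum_fset (fset_set (range g)) | y != 0%R].
have us : uniq s by apply: filter_uniq; exact: finmap.fset_uniq.
have sP y : (y \in s) = (y != 0%R) && (y \in range g).
  by rewrite mem_filter in_fset_set.
exists (size s), (fun i : 'I_(size s) => nth 0%R s i),
  (fun i : 'I_(size s) => g @^-1` [set nth 0%R s i] `&` B); split.
- move=> i; have : nth 0%R s i \in s by rewrite mem_nth.
  rewrite sP lt0r => /andP[-> /set_mem[z _ <-]] /=.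
  exact: fun_ge0.
- move=> i; apply: measurableI => //.
- by move=> i z [].
- move=> i j ij; apply/seteqP; split => // z [[/= -> _] [/= /eqP + _]].
  by rewrite nth_uniq// => /eqP/val_inj/eqP; rewrite (negbTE ij).
- move=> z.
  have E y : (y * \1_(g @^-1` [set y] `&` B) z = if y == g z then g z * \1_B z else 0)%R.
    rewrite !indicE in_setI; case: eqP => [->|yg].
      by congr (_ * _%:R)%R; rewrite mem_set.
    by rewrite (_ : (z \in _) = false) ?mulr0//; apply/negbTE/negP => /set_mem/= /esym.
  under eq_bigr do rewrite E.
  (* The sum over indices becomes a sum over the list of values, in which [g z] occurs exactly once,
     or not at all when it is 0. *)
  rewrite -(big_mkord xpredT (fun i => if nth 0%R s i == g z then g z * \1_B z else 0)%R).
  rewrite -(big_nth 0%R xpredT (fun y => if y == g z then g z * \1_B z else 0)%R).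
  have [gs|gs] := boolP (g z \in s).
    rewrite (bigD1_seq (g z))//= eqxx big1 ?addr0// => y /negbTE yg.
    by rewrite yg.
  rewrite big_seq big1; last first.
    by move=> y ys; case: eqP => // yg; rewrite -yg ys in gs.
  move: gs; rewrite sP mem_set; last by exists z.
  by rewrite andbT negbK => /eqP ->; rewrite mul0r.
Qed.

(** By disjointness at most one indicator is nonzero at each point, so the nonlinear map
    [1 - expR (- (s * _))] distributes over the sum. *)
Lemma integral_one_sub_exp_simple d (T : measurableType d)
    (nu : {measure set T -> \bar R}) (k : T -> R) m (c : 'I_m -> R) (A : 'I_m -> set T) (s : R) :
  measurable_fun setT k -> (forall z, 0 <= k z)%R -> (0 <= s)%R ->
  (forall i, 0 < c i)%R -> (forall i, measurable (A i)) ->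
  (forall i j, i != j -> A i `&` A j = set0) ->
  \int[nu]_z ((1 - expR (- (s * \sum_(i < m) c i * \1_(A i) z))) * k z)%:E =
  \sum_(i < m) (1 - expR (- (s * c i)))%:E * \int[nu]_(z in A i) (k z)%:E.
Proof.
move=> mk k0 s0 c0 mA dA.
have e0 i : (0 <= 1 - expR (- (s * c i)))%R.
  by rewrite subr_ge0 -expR0 ler_expR oppr_le0 mulr_ge0// ltW.
transitivity (\int[nu]_z \sum_(i < m) ((1 - expR (- (s * c i))) * (\1_(A i) z * k z))%:E).
  apply: eq_integral => z _; rewrite sumEFin; congr EFin.
  under [RHS]eq_bigr do rewrite mulrA.
  rewrite -mulr_suml; congr (_ * _)%R.
  have [[i Aiz]|nA] := pselect (exists i, A i z).
    have A0 j : j != i -> \1_(A j) z = 0%R :> R.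
      move=> ji; rewrite indicE memNset// => Ajz.
      by have := dA _ _ ji; rewrite -subset0 => /(_ z); apply.
    have A1 : \1_(A i) z = 1%R :> R by rewrite indicE mem_set.
    rewrite (bigD1 i)//= big1 => [|j /A0 ->]; last by rewrite mulr0.
    rewrite A1 mulr1 addr0 (bigD1 i)//= A1 big1 => [|j /A0 ->]; last by rewrite mulr0.
    by rewrite mulr1 addr0.
  have A0 j : \1_(A j) z = 0%R :> R.
    by rewrite indicE memNset// => Ajz; apply: nA; exists j.
  rewrite big1 => [|j _]; last by rewrite A0 mulr0.
  by rewrite mulr0 oppr0 expR0 subrr big1// => j _; rewrite A0 mulr0.
rewrite ge0_integral_sum//; last 2 first.
- move=> i; apply/measurable_EFinP; apply: measurable_funM => //.
  by apply: measurable_funM.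
- by move=> i z _; rewrite lee_fin !mulr_ge0.
apply: eq_bigr => i _; under eq_integral do rewrite EFinM.
rewrite ge0_integralZl_EFin//; last 2 first.
- by move=> z _; rewrite lee_fin mulr_ge0.
- by apply/measurable_EFinP; apply: measurable_funM.
congr (_ * _); rewrite [RHS]integral_mkcond; apply: eq_integral => z _.
by rewrite patchE indicE; case: (z \in A i); rewrite ?mul1r ?mul0r.
Qed.

Section laplace.
Context d (Om : measurableType d) (P : probability Om R) d' (T : measurableType d')
  (nu : {measure set T -> \bar R}) (k : T -> R) (h : Om -> R) (Phi : Om -> set T).
Hypotheses (mk : measurable_fun setT k) (k0 : forall z, (0 <= k z)%R).
Let Lam (A : set T) := \int[nu]_(z in A) (k z)%:E.
Hypothesis mh : measurable_fun setT h.
Hypothesis mN : forall A, measurable A -> Lam A < +oo ->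
  forall j : nat, measurable [set w | @count_pts R _ (Phi w) A = j%:R%:E].
(** The exponential tail of [h], the Poisson law and independence are merged into one formula, in
    the shape that [probability_poisson_mixture] expects of its family [F], with [a = 1]. *)
Hypothesis joint : forall (t : R) n (A : 'I_n -> set T) (j : 'I_n -> nat), (0 <= t)%R ->
  (forall i, measurable (A i)) -> (forall i, Lam (A i) < +oo) ->
  (forall i i', i != i' -> A i `&` A i' = set0) ->
  P ([set w | t <= h w]%R `&`
     \bigcap_(i in [set: 'I_n]) [set w | @count_pts R _ (Phi w) (A i) = (j i)%:R%:E]) =
  (expR (- t) * \prod_(i < n) pois_pmf (fine (Lam (A i))) (j i))%:E.

(** The event says that all counts [N i] are finite and that [h] is at least [s * b] plus the sum of
    the [s * c i * N i]: the Poisson mixture with threshold [s * b] and coefficients [s * c i]. *)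
Lemma laplace_functional_simple m (c : 'I_m -> R) (A : 'I_m -> set T) (s b : R) :
  (0 < s)%R -> (0 <= b)%R ->
  (forall i, 0 < c i)%R -> (forall i, measurable (A i)) ->
  (forall i, Lam (A i) < +oo) -> (forall i j, i != j -> A i `&` A j = set0) ->
  let f z := (\sum_(i < m) c i * \1_(A i) z)%R in
  let J := fun w => \esum_(z in Phi w) (f z)%:E in
  let L := \int[nu]_z ((1 - expR (- (s * f z))) * k z)%:E in
  [/\ measurable_fun setT J, L \is a fin_num &
  P [set w | J w <= (h w / s - b)%:E] = (expR (- (s * b + fine L)))%:E].
Proof.
move=> s0 b0 c0 mA LA dA f J L.
have LA0 i : 0 <= Lam (A i) by apply: integral_ge0 => z _; rewrite lee_fin.
have LAf i : Lam (A i) \is a fin_num by rewrite ge0_fin_numE.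
pose N i w := @count_pts R _ (Phi w) (A i).
have IE w : J w = \sum_(i < m) (c i)%:E * N i w.
  by rewrite /J esum_simple// => i; exact: ltW.
have LE : L = (\sum_(i < m) (1 - expR (- (s * c i))) * fine (Lam (A i)))%:E.
  rewrite /L integral_one_sub_exp_simple//; last exact: ltW.
  rewrite -sumEFin; apply: eq_bigr => i _; rewrite EFinM fineK//.
split; last 1 first.
- pose F (t : R) := [set w | t <= h w]%R.
  have mF t : measurable (F t).
    by rewrite -[X in measurable X]setTI; exact: measurable_fun_le.
  have PF t (j : 'I_m -> nat) : (0 <= t)%R ->
      P (F t `&` \bigcap_(i in [set: 'I_m]) [set w | N i w = (j i)%:R%:E]) =
      (1 * expR (- t) * \prod_(i < m) pois_pmf (fine (Lam (A i))) (j i))%:E.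
    by move=> t0; rewrite mul1r; exact: joint.
  have sc0 i : (0 <= s * c i)%R by rewrite mulr_ge0// ltW.
  have fL0 i : (0 <= fine (Lam (A i)))%R by exact: fine_ge0.
  have mNA i (j : nat) : measurable [set w | N i w = j%:R%:E] by exact: mN.
  have sb0 : (0 <= s * b)%R by rewrite mulr_ge0// ltW.
  have [_] := probability_poisson_mixture ler01 sc0 fL0 mF mNA PF sb0.
  set E := [set w | exists _, _] => PE.
  rewrite (_ : [set w | _] = E); last first.
    apply/seteqP; split => w /=; last first.
      move=> [j [Nj Fw]]; rewrite IE.
      under eq_bigr do rewrite Nj -EFinM.
      rewrite sumEFin lee_fin lerBrDr ler_pdivlMr//.
      apply: le_trans Fw; rewrite mulrDl (mulrC b) addrC lerD2l.
      by rewrite mulr_suml ler_sum// => i _; rewrite mulrAC (mulrC (c i)).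
    rewrite IE => Iw.
    (* An infinite count with a positive coefficient would make [J w] infinite, against its real
       upper bound. *)
    have Nfin i : exists j : nat, N i w = j%:R%:E.
      have [//|Ny] := @count_pts_nat_or_pinfty R _ (Phi w) (A i).
      exfalso; move: Iw; rewrite (bigD1 i)//= [N i w]Ny gt0_muley ?lte_fin//.
      rewrite addye ?leye_eq// -ltNye (@lt_le_trans _ _ 0)// ?ltNy0//.
      apply: sume_ge0 => j _; rewrite mule_ge0// ?lee_fin ?(ltW (c0 j))//.
      exact: esum_ge0.
    have [j Nj] := choice Nfin.
    exists j; split => //; rewrite /F/=.
    move: Iw; rewrite (eq_bigr (fun i => (c i * (j i)%:R)%:E)); last first.
      by move=> i _; rewrite Nj.
    rewrite sumEFin lee_fin lerBrDr ler_pdivlMr//; apply: le_trans.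
    rewrite mulrDl (mulrC b) addrC lerD2r.
    by rewrite mulr_suml ler_sum// => i _; rewrite (mulrC s) mulrAC.
  rewrite PE mul1r LE/= opprD expRD; congr (_ * _)%:E.
  by rewrite -sumrN expR_sum; apply: eq_bigr => i _; rewrite mulrC.
- rewrite (_ : J = (fun w => \sum_(i < m) (c i)%:E * N i w)); last exact/funext.
  apply: emeasurable_sum => i; apply: emeasurable_funM => //.
  by apply: measurable_count_pts; exact: mN.
- by rewrite LE.
Qed.

(** The simple approximations [g n] are cut by [B n] so that all their pieces have finite mass. The
    cut functions still increase to [f], because the [B n] increase to the whole space. *)
Lemma laplace_functional (f : T -> R) (B : (set T)^nat) (s b L : R) :
  measurable_fun setT f -> (forall z, 0 <= f z)%R ->
  (forall n, measurable (B n)) -> (forall n, Lam (B n) < +oo) ->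
  nondecreasing_seq B -> \bigcup_n B n = setT ->
  (0 < s)%R -> (0 <= b)%R ->
  \int[nu]_z ((1 - expR (- (s * f z))) * k z)%:E = L%:E ->
  let I := fun w => \esum_(z in Phi w) (f z)%:E in
  measurable_fun setT I /\
  P [set w | I w <= (h w / s - b)%:E] = (expR (- (s * b + L)))%:E.
Proof.
move=> mf f0 mB LB ndB UB s0 b0 LE I.
have mfE : measurable_fun setT (EFin \o f) by exact/measurable_EFinP.
pose g := nnsfun_approx measurableT mfE.
pose fn n z := (g n z * \1_(B n) z)%R.
have gz z : g ^~ z @ \oo --> f z.
  have := @cvg_nnsfun_approx _ _ _ _ measurableT _ mfE (fun x _ => f0 x) z Logic.I.
  by move=> /fine_cvg.
have gf n z : (g n z <= f z)%R.
  have nd : nondecreasing_seq (g ^~ z) by move=> i j ij; exact/lefP/nd_nnsfun_approx.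
  rewrite -(cvg_lim (@norm_hausdorff _ R) (gz z)).
  by apply: nondecreasing_cvgn_le => //; apply/cvg_ex; exists (f z); exact: gz.
have fn0 n z : (0 <= fn n z)%R by rewrite mulr_ge0.
have ind01 n z : (\1_(B n) z <= 1 :> R)%R by rewrite indicE lern1 leq_b1.
have fnf n z : (fn n z <= f z)%R.
  apply: le_trans (gf n z); rewrite ler_piMr//.
have ndfn z : nondecreasing_seq (fn ^~ z).
  move=> i j ij; apply: ler_pM => //.
    exact/lefP/nd_nnsfun_approx.
  rewrite !indicE; have [Bi|] := boolP (z \in B i) => //.
  by rewrite (mem_set (subsetPset _ _ (ndB _ _ ij) z (set_mem Bi))).
have cvfn z : fn ^~ z @ \oo --> f z.
  have [n0 _ Bn0] : (\bigcup_n B n) z by rewrite UB.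
  apply: cvg_trans (gz z); apply: near_eq_cvg; near=> n.
  have Bn : B n z.
    apply: (subsetPset _ _ (ndB n0 n _) z Bn0); near: n; exact: nbhs_infty_ge.
  by rewrite /fn indicE mem_set// mulr1.
pose In n w := \esum_(z in Phi w) (fn n z)%:E.
pose Ln n := \int[nu]_z ((1 - expR (- (s * fn n z))) * k z)%:E.
have S n : [/\ measurable_fun setT (In n), Ln n \is a fin_num &
   P [set w | In n w <= (h w / s - b)%:E] = (expR (- (s * b + fine (Ln n))))%:E].
  have [m [c [A [c0 mA AB dA E]]]] := nnsfun_disjoint_decomp (g n) (mB n).
  have fE : fn n = (fun z => \sum_(i < m) c i * \1_(A i) z)%R by apply/funext.
  rewrite /Ln /In fE; apply: laplace_functional_simple => // i.
  apply: le_lt_trans (LB n); apply: ge0_subset_integral => //.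
  - by apply: measurable_funTS; exact/measurable_EFinP.
  - by move=> z _; rewrite lee_fin.
have InI n w : In n w <= I w by apply: le_esum => z _; rewrite lee_fin.
have IIn w x : (forall n, In n w <= x) -> I w <= x.
  exact: (@esum_le_of_cvg R _ (Phi w) fn f cvfn).
(* [I] is the supremum of the [In n]: each lies below [I], and any common bound of them bounds
   [I]. *)
have mI : measurable_fun setT I.
  rewrite (_ : I = (fun w => esups (In ^~ w) 0%N)).
    by apply: measurable_fun_esups => n; have [] := S n.
  apply/funext => w; apply/eqP; rewrite eq_le; apply/andP; split.
    by apply: IIn => n; apply: ereal_sup_ubound; exists n.
  by apply: ub_ereal_sup => _ [n _ <-].
split => //.
pose E n := [set w | In n w <= (h w / s - b)%:E].
have mhs : measurable_fun setT (fun w => (h w / s - b)%:E).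
  by apply/measurable_EFinP; apply: measurable_funB => //; exact: measurable_funM.
have mE (J : Om -> \bar R) : measurable_fun setT J -> measurable [set w | J w <= (h w / s - b)%:E].
  by move=> mJ; rewrite -[X in measurable X]setTI; exact: measurable_lee.
have capE : [set w | I w <= (h w / s - b)%:E] = \bigcap_n E n.
  apply/seteqP; split => w /=.
    by move=> Iw n _; exact: le_trans (InI n w) Iw.
  by move=> H; apply: IIn => n; exact: H.
rewrite capE.
have c1 := @nonincreasing_cvg_mu _ _ _ P E.
apply: cvg_unique (c1 _ _ _ _) _ => //.
- by apply: (le_lt_trans (probability_le1 P _)); rewrite ?ltry//; apply: mE; have [] := S 0%N.
- by move=> n; apply: mE; have [] := S n.
- by rewrite -capE; exact: mE.
- move=> n m nm; apply/subsetPset => w; apply: le_trans.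
  by apply: le_esum => z _; rewrite lee_fin; exact: ndfn.
have -> : P \o E = (fun n => (expR (- (s * b + fine (Ln n))))%:E).
  by apply/funext => n; have [] := S n.
apply: cvg_EFin; first by near=> n.
apply: (@cvg_comp _ _ _ (fun n => - (s * b + fine (Ln n)))%R expR); last exact: continuous_expR.
apply: cvgN; apply: cvgD; first exact: cvg_cst.
(* The exponents converge by monotone convergence, and since the limit [L] is real the convergence
   survives [fine]. *)
apply: fine_cvg; rewrite -LE.
rewrite (_ : (fun z => ((1 - expR (- (s * f z))) * k z)%:E) =
  fun z => limn (fun n => ((1 - expR (- (s * fn n z))) * k z)%:E)); last first.
  apply/funext => z; apply/esym/cvg_lim => //.
  apply: cvg_EFin; first by near=> n.
  apply: cvgMr_tmp; apply: cvgB; first exact: cvg_cst.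
  apply: (@cvg_comp _ _ _ (fun n => - (s * fn n z))%R expR); last exact: continuous_expR.
  by apply: cvgN; apply: cvgMl_tmp; exact: cvfn.
apply: cvg_monotone_convergence => //.
- move=> n; apply/measurable_EFinP; apply: measurable_funM => //.
  apply: measurable_funB => //; apply: (measurableT_comp (@measurable_expR R)).
  apply: measurableT_comp => //; apply: measurable_funM => //.
  exact: measurable_funM.
- move=> n z _; rewrite lee_fin mulr_ge0// subr_ge0 -expR0 ler_expR oppr_le0.
  by rewrite mulr_ge0// ltW.
- move=> z _ n m nm; rewrite lee_fin ler_wpM2r// lerB// ler_expR lerN2.
  by rewrite ler_wpM2l ?(ltW s0)//; exact: ndfn.
Unshelve. all: by end_near. Qed.

End laplace.
End poisson_functional.

(** * Mean rate as an integral of tail probabilities *)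

Section rate.
Context {R : realType}.
Local Notation mu := (@lebesgue_measure R).

Lemma integral_layer_cake d (Om : measurableType d) (P : probability Om R) (X : Om -> R) :
  measurable_fun setT X -> (forall w, 0 <= X w) ->
  (\int[P]_w (X w)%:E = \int[mu]_(t in `]0%R, +oo[) P [set w | (t <= X w)%R])%E.
Proof.
move=> mX X0.
pose K (z : Om * R) : \bar R := if (0 < z.2) && (z.2 <= X z.1) then 1%E else 0%E.
have K0 z : (0 <= K z)%E by rewrite /K; case: ifP.
have mK : measurable_fun setT K.
  apply: measurable_fun_ifT => //.
  apply: measurable_and; first by apply: measurable_fun_ltr.
  by apply: measurable_fun_ler => //; exact: measurableT_comp.
transitivity (\int[P]_w \int[mu]_t K (w, t))%E.
  apply: eq_integral => w _; rewrite /K/= integral_if.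
  rewrite [X in integral _ X _](_ : _ = `]0, X w]%classic); last first.
    by apply/seteqP; split => t/=; rewrite in_itv.
  rewrite integral_cst//= mul1e lebesgue_measure_itv/= lte_fin.
  case: ltP => h; first by rewrite sube0.
  by congr EFin; apply/eqP; rewrite eq_le h X0.
rewrite (@fubini_tonelli _ _ Om _ R P mu K)// integral_itv0y_if.
apply: eq_integral => t _; rewrite /K/=.
have [t0|t0] /= := ltP 0 t; last by rewrite integral0.
rewrite integral_if integral_cst//= ?mul1e//.
by rewrite -[X in measurable X]setTI; exact: measurable_fun_le.
Qed.

(** Here [xa] stands for the path loss and [c] for the normalised noise. The rate can be negative
    only where [h] is, a null event, so it is replaced by its positive part before the layer-cake
    formula is applied. *)
Lemma expectation_rate d (Om : measurableType d) (P : probability Om R)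
    (J : Om -> \bar R) (h : Om -> R) (xa c : R) :
  measurable_fun setT J -> measurable_fun setT h ->
  (forall w, (0 <= J w)%E) -> P [set w | h w < 0] = 0%E -> 0 < xa -> 0 < c ->
  (\int[P]_w (ln (1 + (if J w \is a fin_num then h w * xa^-1 / (fine (J w) + c) else 0)))%:E
   = \int[mu]_(t in `]0%R, +oo[)
       P [set w | (J w <= (h w / (xa * (expR t - 1)) - c)%:E)%E])%E.
Proof.
move=> mJ mh J0 Ph xa0 c0.
pose Y w : R := if J w \is a fin_num then h w * xa^-1 / (fine (J w) + c) else 0.
have fJ0 w : 0 <= fine (J w) by exact: fine_ge0.
have Jc w : 0 < fine (J w) + c by rewrite ltr_wpDl.
have mY : measurable_fun setT Y.
  apply: measurable_fun_ifT => //.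
    rewrite (_ : (fun w => J w \is a fin_num) = (fun w => (J w < +oo)%E)).
      exact: measurable_fun_lte.
    by apply/funext => w; rewrite ge0_fin_numE.
  apply: measurable_funM; first exact: measurable_funM.
  apply: (measurableT_comp measurable_invr); apply: measurable_funD => //.
  by apply: measurableT_comp => //; exact: fine_measurable.
pose X w : R := ln (1 + Y w).
have mX : measurable_fun setT X.
  by apply: (measurableT_comp (@measurable_ln R)); exact: measurable_funD.
pose X' w : R := Num.max (X w) 0.
have mX' : measurable_fun setT X' by exact: measurable_maxr.
transitivity (\int[P]_w (X' w)%:E)%E.
  apply: ae_eq_integral => //; [exact/measurable_EFinP|exact/measurable_EFinP|].
  exists [set w | h w < 0]; split => //.
    exact: measurable_set_ltr.
  move=> w /=; apply: contra_notP => /negP; rewrite -leNgt => hw _.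
  congr EFin; rewrite /X' max_l// /X ln_ge0// lerDl /Y; case: ifP => // _.
  by rewrite !mulr_ge0 ?invr_ge0// ltW.
rewrite integral_layer_cake//; last by move=> w; rewrite le_max lexx orbT.
apply: eq_integral => t /set_mem; rewrite /= in_itv/= andbT => t0; congr (P _).
have et : 0 < expR t - 1 by rewrite subr_gt0 -expR0 ltr_expR.
have s0 : 0 < xa * (expR t - 1) by rewrite mulr_gt0.
apply: eq_set => w; apply/propext.
have -> : (t <= X' w) = (expR t - 1 <= Y w).
  rewrite le_max (leNgt t 0) t0 orbF /X lerBlDl.
  (* At nonpositive arguments [ln] takes the value 0, which is below [t]; there [expR t - 1 <= Y w]
     fails too. *)
  have [y0|y0] := ltP 0 (1 + Y w).
    by rewrite -[in RHS](lnK y0) ler_expR.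
  rewrite ln0// !leNgt t0/=; apply/esym/negbTE; rewrite negbK.
  by rewrite (le_lt_trans y0)// expR_gt0.
rewrite /Y; case: ifPn => [fin|nfin].
  rewrite -[in X in _ <-> X](fineK fin) lee_fin lerBrDr ler_pdivlMr// ler_pdivlMr//.
  rewrite ler_pdivlMr//.
  by rewrite (_ : _ * _ * xa = (fine (J w) + c) * (xa * (expR t - 1)))//; ring.
(* With infinite interference both sides are false: the SINR is set to 0, and [+oo] is not below a
   real number. *)
split; first by rewrite leNgt et.
move: nfin; rewrite ge0_fin_numE// -leNgt leye_eq => /eqP ->.
by rewrite leye_eq.
Qed.

Lemma sigma_finite_lebesgue2 : sigma_finite setT (mu \x mu)%E.
Proof.
exists (fun n => `]- n%:R, n%:R]%classic `*` `]- n%:R, n%:R]%classic) => [|n].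
  apply/esym/seteqP; split => // -[x y] _.
  exists (truncn (`|x| + `|y|)).+1 => //; split => /=; rewrite in_itv/=.
    have : `|x| < (truncn (`|x| + `|y|)).+1%:R.
      by rewrite (le_lt_trans _ (truncnS_gt _))// lerDl.
    by rewrite ltr_norml => /andP[-> /ltW ->].
  have : `|y| < (truncn (`|x| + `|y|)).+1%:R.
    by rewrite (le_lt_trans _ (truncnS_gt _))// lerDr.
  by rewrite ltr_norml => /andP[-> /ltW ->].
split; first by apply: measurableX; exact: measurable_itv.
rewrite product_measure1E; [|exact: measurable_itv|exact: measurable_itv].
by rewrite /= lebesgue_measure_itv/=; case: ifP => _; rewrite -?EFinB -?EFinM ?mul0e ltry.
Qed.

Lemma integral_marked_radial (u : R * R -> R) (V : R -> R) :
  measurable_fun setT u -> (forall z, 0 <= u z) ->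
  measurable_fun setT V -> (forall r, 0 <= V r) ->
  (forall r, 0 <= r -> (\int[mu]_y (u (r, y))%:E = (V r)%:E)%E) ->
  (\int[((mu \x mu) \x mu)%E]_z (u (dist0 z.1, z.2))%:E
   = (2 * pi)%:E * \int[mu]_(r in `]0%R, +oo[) (r * V r)%:E)%E.
Proof.
move=> mu_ u0 mV V0 uV.
have mu2 : measurable_fun setT (fun z : (R * R) * R => (u (dist0 z.1, z.2))%:E).
  apply/measurable_EFinP; apply: (measurableT_comp mu_).
  apply: measurable_fun_pair => //.
  exact: (measurableT_comp measurable_dist0).
(* The s-finite canonical instance found on a product measure is the one for
   subprobabilities, so the sigma-finite structure is packed by hand. *)
pose m1 : {sigma_finite_measure set _ -> \bar R} :=
  HB.pack_for {sigma_finite_measure set _ -> \bar R} (mu \x mu)%E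
    (Measure_isSigmaFinite.Build _ _ _ (mu \x mu)%E sigma_finite_lebesgue2).
transitivity (\int[(mu \x mu)%E]_p \int[mu]_y (u (dist0 p, y))%:E)%E.
  by apply: (@fubini_tonelli1 _ _ _ _ R m1 mu _ mu2) => z; rewrite lee_fin.
rewrite -integral_radial//; apply: eq_integral => p _.
by rewrite uV// sqrtr_ge0.
Qed.

Lemma integral_exponential_pdf_tail (a : R) : 0 <= a ->
  (\int[mu]_(t in `[a, +oo[) (exponential_pdf 1 t)%:E = (expR (- a))%:E)%E.
Proof.
move=> a0; have := @integral_expRN R 1 a ltr01; rewrite mul1r => <-.
apply: eq_integral => t /set_mem; rewrite /= in_itv/= andbT => at_.
by rewrite exponential_pdfE ?(le_trans a0)// mulN1r !mul1r.
Qed.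

(** The [max] mirrors the truncation in [received_power]; the density vanishes on negative marks,
    which reduces the integral to the half-line. *)
Lemma integral_laplace_exp_pdf (q : R) : 0 <= q ->
  (\int[mu]_y ((1 - expR (- (Num.max (q * y) 0))) * exponential_pdf 1 y)%:E
   = (q / (1 + q))%:E)%E.
Proof.
move=> q0; rewrite -integral_laplace_exp// [RHS]integral_mkcond.
apply: eq_integral => y _; rewrite patchE.
have [y0|y0] := leP 0 y.
  rewrite mem_set/=; last by rewrite in_itv/= y0.
  by rewrite exponential_pdfE// max_l ?mulr_ge0// mulN1r mul1r.
rewrite memNset/=; last by rewrite in_itv/= leNgt y0.
by rewrite lt0_exponential_pdf// mulr0.
Qed.

(** The supremum ranges over all finite subsets, so negative terms can always be dropped from a
    competing subset. *)
Lemma esum_max0 (T : choiceType) (S : set T) (f : T -> R) :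
  (\esum_(z in S) (f z)%:E = \esum_(z in S) (Num.max (f z) 0)%:E)%E.
Proof.
apply/eqP; rewrite eq_le; apply/andP; split.
  by apply: le_esum => z _; rewrite lee_fin le_max lexx.
apply: ub_ereal_sup => _ /= [A [finA AS] <-].
rewrite (_ : (\sum_(z \in A) _ = \sum_(z \in A `&` [set z | (0 <= f z)%R]) (f z)%:E)%E).
  apply: ereal_sup_ubound; exists (A `&` [set z | 0 <= f z]) => //; split.
    exact: finite_setIl.
  by move=> z [/AS].
rewrite [RHS]fsbig_mkcondr; apply: eq_fsbigr => z _.
have [fz|fz] := leP 0 (f z); first by rewrite mem_set.
by rewrite memNset//= leNgt fz.
Qed.

End rate.

(** * The serving distance and the event A_UE *)

Section network.
Context {R : realType}.
Local Notation mu := (@lebesgue_measure R).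
Variables (lamb alpha P N M mu_ : R).
Hypotheses (hlamb : 0 < lamb) (halpha : 2 < alpha) (hP : 0 < P) (hN : 0 < N)
  (hM : 1 <= M) (hmu : 1 <= mu_ <= 2).

Local Notation rho := (rho alpha P N M mu_).
Local Notation thr := (thr alpha P N M mu_).
Local Notation AUE := (AUE alpha P N M mu_).
Local Notation PAUE := (PAUE lamb alpha P N M mu_).

Let mu0 : 0 < mu_. Proof. by case/andP: hmu => h _; exact: lt_le_trans h. Qed.
Let a0 : 0 < alpha. Proof. exact: lt_trans halpha. Qed.
Let M0 : 0 < M. Proof. exact: lt_le_trans hM. Qed.
Let pl0 : 0 < pi * lamb. Proof. by rewrite mulr_gt0// pi_gt0. Qed.

(** Solving [x <= thr y] for [y] means dividing by the constant of [thr] and raising to the power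
    [mu_ / 2]. The bound obtained is the second argument of the [max] in [rho], which is where [rho]
    comes from. *)
Lemma le_thr (x y : R) : 0 < x -> 0 < y ->
  (x <= thr y) = (x `^ (mu_ / 2) * (P / N) `^ ((2 - mu_) / (2 * alpha)) *
                   (1 / M) `^ (1 / (2 * alpha)) <= y).
Proof.
move=> x0 y0; rewrite /Defs.thr.
have NP : 0 < N / P by rewrite divr_gt0.
have -> : P / N = (N / P) `^ (-1) by rewrite powR_inv1 ?ltW// invf_div.
move: (N / P) NP => q q0.
set K := M `^ _ * _.
have K0 : 0 < K by rewrite mulr_gt0// powR_gt0.
rewrite mulrC -ler_pdivrMr//.
have m2 : 0 < mu_ / 2 by rewrite divr_gt0.
have xK : 0 <= x / K by rewrite divr_ge0// ltW.
have -> : (x / K <= y `^ (2 / mu_)) = ((x / K) `^ (mu_ / 2) <= y).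
  have yE : y = (y `^ (2 / mu_)) `^ (mu_ / 2).
    rewrite -powRrM (_ : 2 / mu_ * (mu_ / 2) = 1) ?powRr1 ?ltW//.
    by field; rewrite gt_eqF.
  rewrite [in RHS]yE; apply/idP/idP => [h|].
    by apply: ge0_ler_powR; rewrite ?nnegrE ?powR_ge0// ltW.
  apply: contraTT; rewrite -!ltNge => h.
  by apply: gt0_ltr_powR; rewrite ?nnegrE ?powR_ge0.
congr (_ <= _); rewrite powRM ?invr_ge0 ?(ltW x0) ?(ltW K0)// -mulrA; congr (_ * _).
rewrite /K invfM -powRN -powRN powRM ?powR_ge0// -!powRrM.
have -> : 1 / M = M `^ (-1) by rewrite powR_inv1 ?ltW// div1r.
rewrite -!powRrM mulrC; congr (_ `^ _ * _ `^ _); field; rewrite ?gt_eqF//.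
Qed.

Lemma rho_gt0 x : 0 < x -> 0 < rho x.
Proof. by move=> x0; rewrite /Defs.rho lt_max x0. Qed.

Lemma measurable_thr : measurable_fun setT thr.
Proof. by apply: measurable_funM => //; exact: measurable_powR. Qed.

Lemma measurable_rho : measurable_fun setT rho.
Proof.
apply: measurable_maxr => //; apply: measurable_funM => //; apply: measurable_funM => //.
Qed.

Lemma joint_density_ge0 (z : R * R) : 0 <= joint_density lamb z.
Proof.
rewrite /joint_density; case: ifPn => // /andP[z1 z12].
rewrite mulr_ge0 ?expR_ge0// mulr_ge0 ?(ltW (lt_trans z1 z12))//.
by rewrite mulr_ge0 ?sqr_ge0// ltW.
Qed.

Lemma measurable_joint_density : measurable_fun setT (@joint_density R lamb).
Proof.
apply: measurable_fun_ifT => //.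
  by apply: measurable_and; apply: measurable_fun_ltr.
apply: measurable_funM.
  by apply: measurable_funM => //; apply: measurable_funM.
apply: (measurableT_comp (@measurable_expR R)); apply: measurableT_comp => //.
by apply: measurable_funM => //; apply: measurable_funX.
Qed.

Lemma integral_AUE (f : R * R -> \bar R) :
  (\int[(mu \x mu)%E]_(z in AUE) f z =
   \int[(mu \x mu)%E]_z (if (z.1 <= thr z.2)%R then f z else 0))%E.
Proof. by rewrite integral_if. Qed.

Lemma measurable_AUE_if (f : R * R -> \bar R) : measurable_fun setT f ->
  measurable_fun setT (fun z : R * R => if (z.1 <= thr z.2)%R then f z else 0%E).
Proof.
move=> mf; apply: measurable_fun_ifT => //.
by apply: measurable_fun_ler => //; apply: (measurableT_comp measurable_thr).
Qed.

(** At fixed [x], the constraint [x < y] and the event [AUE] together say that [y] lies beyond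
    [rho x], and the Gaussian tail integrates exactly. Divided by the probability of [AUE], this is
    the conditional density of [X11]. *)
Lemma marginal_X11 (x : R) : 0 < x ->
  (\int[mu]_y (if (x <= thr y)%R then (joint_density lamb (x, y))%:E else 0) =
   (2 * pi * lamb * x * expR (- (pi * lamb * rho x ^+ 2)))%:E)%E.
Proof.
move=> x0.
pose f (y : R) := (2 * (pi * lamb) * y * expR (- (pi * lamb * y ^+ 2)))%:E.
have mf D : measurable_fun D f.
  apply/measurable_EFinP; apply: measurable_funTS; apply: measurable_funM => //.
  apply: (measurableT_comp (@measurable_expR R)); apply: measurableT_comp => //.
  by apply: measurable_funM => //; apply: measurable_funX.
pose p (y : R) := (x < y) && (x <= thr y).
transitivity (\int[mu]_y (if p y then ((2 * pi * lamb * x)%:E * f y) else 0))%E.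
  apply: eq_integral => y _; rewrite /p /joint_density/= x0/=.
  case: (x <= thr y); case: (x < y) => //=.
  by rewrite /f -EFinM; congr EFin; ring.
rewrite integral_if.
(* The endpoint is excluded when [rho x] is [x], from the strict [x < y], and included when the
   threshold dominates strictly. Both half-lines have the same integral. *)
have pS : [set y | p y] = `]rho x, +oo[%classic \/ [set y | p y] = `[rho x, +oo[%classic.
  set c := x `^ (mu_ / 2) * (P / N) `^ ((2 - mu_) / (2 * alpha)) * (1 / M) `^ (1 / (2 * alpha)).
  have pE y : p y = (x < y) && (c <= y).
    rewrite /p; case: (ltP x y) => //= xy; rewrite le_thr//; exact: lt_trans xy.
  have [xc|cx] := ltP x c; [right|left]; apply/seteqP; split => y /=; rewrite in_itv/= andbT pE /Defs.rho -/c.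
  - by move=> /andP[xy cy]; rewrite ge_max cy ltW.
  - by rewrite ge_max => /andP[_ cy]; rewrite cy (lt_le_trans xc).
  - by move=> /andP[xy cy]; rewrite max_l.
  - by rewrite max_l// => xy; rewrite xy ltW// (le_lt_trans cx).
have r0 : 0 <= rho x by rewrite ltW// rho_gt0.
have I2 : (\int[mu]_(y in [set y | p y]) f y = (expR (- (pi * lamb * rho x ^+ 2)))%:E)%E.
  by rewrite -integral_gauss_tail//; case: pS => ->//; rewrite integral_itv_obnd_cbnd.
have pr0 y : p y -> 0 <= y by move=> /andP[xy _]; rewrite ltW// (lt_trans x0).
rewrite ge0_integralZl_EFin//.
- by rewrite I2 -EFinM.
- by case: pS => ->; exact: measurable_itv.
- move=> y /pr0 y0; rewrite lee_fin mulr_ge0 ?expR_ge0//.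
  by rewrite mulr_ge0// mulr_ge0// ltW.
- exact: mf.
- by rewrite !mulr_ge0 ?pi_ge0// ltW.
Qed.

(** Integrating in [x] first leaves the integral of [x] up to [Num.min y (thr y)]; its factor 1/2
    turns [(2 * pi * lamb) ^+ 2] into [2 * (pi * lamb) ^+ 2]. *)
Lemma PAUE_integral :
  PAUE = (\int[mu]_(y in `]0%R, +oo[)
          (2 * (pi * lamb) ^+ 2 * y * expR (- (pi * lamb * y ^+ 2)) *
           (Num.min y (thr y)) ^+ 2)%:E)%E.
Proof.
rewrite /Defs.PAUE integral_AUE.
rewrite tonelli_yx//; last 2 first.
  by apply: measurable_AUE_if; apply/measurable_EFinP; exact: measurable_joint_density.
  by move=> z; case: ifP => // _; rewrite lee_fin joint_density_ge0.
rewrite integral_itv0y_if; apply: eq_integral => y _.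
have [y0|y0] := ltP 0 y; last first.
  rewrite integral0_eq// => x _; case: ifP => // _.
  rewrite /joint_density/= ifF//; apply/negP => /andP[x0 xy].
  by move: y0; rewrite leNgt (lt_trans x0).
set m := Num.min y (thr y).
have ty0 : 0 < thr y by rewrite /Defs.thr !mulr_gt0 ?powR_gt0 ?divr_gt0.
have m0 : 0 <= m by rewrite le_min !ltW.
pose p (x : R) := (0 < x) && (x < y) && (x <= thr y).
pose c := (2 * pi * lamb) ^+ 2 * y * expR (- (pi * lamb * y ^+ 2)).
have c0 : 0 <= c by rewrite /c mulr_ge0 ?expR_ge0// mulr_ge0 ?sqr_ge0// ltW.
transitivity (\int[mu]_x (if p x then (c%:E * x%:E) else 0))%E.
  apply: eq_integral => x _; rewrite /p /joint_density/=.
  case: (x <= thr y); case: (0 < x); case: (x < y) => //=.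
  by rewrite -EFinM; congr EFin; rewrite /c; ring.
rewrite integral_if.
have pS : [set x | p x] = `]0, m[%classic \/ [set x | p x] = `]0, m]%classic.
  have [ty|yt] := ltP (thr y) y; [right|left]; apply/seteqP; split => x /=; rewrite in_itv/= /p /m.
  - by move=> /andP[/andP[-> xy] xt]; rewrite le_min xt ltW.
  - by rewrite le_min => /andP[-> /andP[_ xt]]; rewrite xt (le_lt_trans xt).
  - by move=> /andP[/andP[-> xy] xt]; rewrite min_l.
  - by rewrite min_l// => /andP[-> xy]; rewrite xy ltW// (lt_le_trans xy).
have I2 : (\int[mu]_(x in [set x | p x]) x%:E = (m ^+ 2 / 2)%:E)%E.
  by rewrite -integral0_id//; case: pS => ->//; rewrite integral_itv_bndo_bndc.
rewrite ge0_integralZl_EFin//.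
- by rewrite I2 -EFinM; congr EFin; rewrite /c; field.
- by case: pS => ->; exact: measurable_itv.
- by move=> x /= /andP[/andP[x0 _] _]; rewrite lee_fin ltW.
Qed.

Lemma fine_PAUE_ge0 : 0 <= fine PAUE.
Proof. by apply: fine_ge0; apply: integral_ge0 => z _; rewrite lee_fin joint_density_ge0. Qed.

(** Real powers are nonnegative, so Euler's integrand is nonnegative for every real argument and
    measurability of a parametric integral applies. It is needed to integrate the rate over [x]. *)
Lemma measurable_hyp2F1 (a b c : R) : measurable_fun setT (hyp2F1 a b c).
Proof.
apply: measurable_funM => //.
apply: measurableT_comp; first exact: fine_measurable.
pose f (z : R * R) : \bar R := if (0 < z.2) && (z.2 < 1) then
  (z.2 `^ (b - 1) * (1 - z.2) `^ (c - b - 1) * (1 - z.1 * z.2) `^ (- a))%:E else 0%E.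
rewrite (_ : (fun z => _) = (fun z => \int[mu]_t f (z, t))%E); last first.
  apply/funext => z; rewrite /f/= integral_if; congr (integral _ _ _).
apply: measurable_integral_param; last first.
  by move=> z; rewrite /f; case: ifP => // _; rewrite lee_fin !mulr_ge0 ?powR_ge0.
apply: measurable_fun_ifT => //.
  by apply: measurable_and; apply: measurable_fun_ltr.
apply/measurable_EFinP; apply: measurable_funM; first apply: measurable_funM.
- by apply: (measurableT_comp (@measurable_powR R (b - 1))).
- apply: (measurableT_comp (@measurable_powR R (c - b - 1))).
  exact: measurable_funB.
- apply: (measurableT_comp (@measurable_powR R (- a))).
  by apply: measurable_funB => //; exact: measurable_funM.
Qed.

(** In the model, for positive [x] and [tau], this is the probability that [ln (1 + SINR)] is at
    least [tau] given [X11 = x]. *)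
Definition rate_integrand (x tau : R) : R :=
  expR (- (N / P * x `^ alpha * (expR tau - 1))) *
  LI lamb alpha P N M mu_ (x `^ alpha * (expR tau - 1)) x.

Lemma measurable_rate_integrand : measurable_fun setT (fun z : R * R => rate_integrand z.1 z.2).
Proof.
have mxa : measurable_fun setT (fun z : R * R => z.1 `^ alpha).
  exact: (measurableT_comp (@measurable_powR R alpha)).
have met : measurable_fun setT (fun z : R * R => expR z.2 - 1).
  by apply: measurable_funB => //; exact: (measurableT_comp (@measurable_expR R)).
have ms : measurable_fun setT (fun z : R * R => z.1 `^ alpha * (expR z.2 - 1)).
  exact: measurable_funM.
have mr a : measurable_fun setT (fun z : R * R => (rho z.1 ^+ 2) `^ a).
  apply: (measurableT_comp (@measurable_powR R a)); apply: measurable_funX.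
  exact: (measurableT_comp measurable_rho).
apply: measurable_funM.
  apply: (measurableT_comp (@measurable_expR R)); apply: measurableT_comp => //.
  by apply: measurable_funM => //; exact: measurable_funM.
apply: (measurableT_comp (@measurable_expR R)); apply: measurableT_comp => //.
apply: measurable_funM.
  by apply: measurable_funM => //; exact: measurable_funM.
apply: (measurableT_comp (measurable_hyp2F1 1 (1 - 2 / alpha) (2 - 2 / alpha))).
by apply: measurable_funM => //; exact: measurableT_comp.
Qed.

Lemma rate_integrand_ge0 x t : 0 <= rate_integrand x t.
Proof. by rewrite mulr_ge0// expR_ge0. Qed.

Definition rate_given (x : R) : \bar R :=
  (\int[mu]_(tau in `]0%R, +oo[) (rate_integrand x tau)%:E)%E.

Lemma measurable_rate_given : measurable_fun setT rate_given.
Proof.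
pose f (z : R * R) : \bar R := if 0 < z.2 then (rate_integrand z.1 z.2)%:E else 0%E.
rewrite (_ : rate_given = (fun x => \int[mu]_t f (x, t))%E); last first.
  by apply/funext => x; rewrite /rate_given integral_itv0y_if.
apply: measurable_integral_param; last first.
  by move=> z; rewrite /f; case: ifP => // _; rewrite lee_fin rate_integrand_ge0.
apply: measurable_fun_ifT => //; first exact: measurable_fun_ltr.
by apply/measurable_EFinP; exact: measurable_rate_integrand.
Qed.

(** [G] is an arbitrary function for which only an identity on positive [x] is given. The density
    vanishes elsewhere, so [G] is replaced by the measurable [rate_given] before Tonelli is used. *)
Lemma integral_joint_rate (G : R -> \bar R) :
  (forall x, 0 < x -> G x = rate_given x) ->
  (\int[(mu \x mu)%E]_(z in AUE) ((joint_density lamb z)%:E * G z.1) =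
   (2 * pi * lamb)%:E * \int[mu]_(x in `]0%R, +oo[)
     ((x * expR (- (pi * lamb * rho x ^+ 2)))%:E * rate_given x))%E.
Proof.
move=> GE; rewrite integral_AUE.
have g0 x : (0 <= rate_given x)%E.
  by apply: integral_ge0 => t _; rewrite lee_fin rate_integrand_ge0.
transitivity (\int[(mu \x mu)%E]_z (if (z.1 <= thr z.2)%R then
    (joint_density lamb z)%:E * rate_given z.1 else 0))%E.
  apply: eq_integral => z _; case: ifP => // _.
  have [z0|z0] := ltP 0 z.1; first by rewrite GE.
  by rewrite /joint_density ltNge z0/= !mul0e.
rewrite tonelli_xy//; last 2 first.
  apply: (@measurable_AUE_if (fun z => (joint_density lamb z)%:E * rate_given z.1)%E).
  apply: emeasurable_funM; last exact: (measurableT_comp measurable_rate_given).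
  by apply/measurable_EFinP; exact: measurable_joint_density.
  by move=> z; case: ifP => // _; rewrite mule_ge0// lee_fin joint_density_ge0.
have mi : measurable_fun setT (fun x : R => (x * expR (- (pi * lamb * rho x ^+ 2)))%:E).
  apply/measurable_EFinP; apply: measurable_funM => //.
  apply: (measurableT_comp (@measurable_expR R)); apply: measurableT_comp => //.
  by apply: measurable_funM => //; apply: measurable_funX; exact: measurable_rho.
rewrite -ge0_integralZl//; last 3 first.
- apply: measurable_funTS; apply: emeasurable_funM => //; exact: measurable_rate_given.
- move=> x /=; rewrite in_itv/= andbT => x0.
  by rewrite mule_ge0// lee_fin mulr_ge0 ?expR_ge0// ltW.
- by rewrite lee_fin !mulr_ge0 ?pi_ge0// ltW.
rewrite integral_itv0y_if; apply: eq_integral => x _.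
have [x0|x0] := ltP 0 x; last first.
  rewrite integral0_eq// => y _; case: ifP => // _.
  by rewrite /joint_density/= ltNge x0/= mul0e.
transitivity (\int[mu]_y ((if (x <= thr y)%R then
    (joint_density lamb (x, y))%:E else 0) * rate_given x))%E.
  by apply: eq_integral => y _; case: ifP => // _; rewrite mul0e.
rewrite ge0_integralZr//; last 2 first.
- apply: measurable_fun_ifT => //.
    by apply: measurable_fun_ler => //; exact: measurable_thr.
  apply/measurable_EFinP; apply: (measurableT_comp measurable_joint_density).
  exact: measurable_pair1.
- by move=> y _; case: ifP => // _; rewrite lee_fin joint_density_ge0.
by rewrite marginal_X11// muleA -EFinM !mulrA.
Qed.

End network.

(** * Interference *)

Section interference.
Context {R : realType}.
Local Notation mu := (@lebesgue_measure R).
Variables (lamb alpha P N M mu_ : R).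
Hypotheses (hlamb : 0 < lamb) (halpha : 2 < alpha) (hP : 0 < P) (hN : 0 < N)
  (hM : 1 <= M) (hmu : 1 <= mu_ <= 2).

Local Notation rho := (rho alpha P N M mu_).
Local Notation PAUE := (PAUE lamb alpha P N M mu_).
Local Notation lam_int := (lam_int lamb alpha P N M mu_).
Local Notation Lam := (Lam lamb alpha P N M mu_).
Local Notation LI := (LI lamb alpha P N M mu_).

Let c0 : 0 <= lamb * fine PAUE.
Proof. by rewrite mulr_ge0 ?fine_PAUE_ge0// ltW. Qed.

Lemma lam_int_ge0 x r : 0 <= lam_int x r.
Proof. by rewrite /Defs.lam_int; case: ifP. Qed.

Lemma measurable_lam_int x : measurable_fun setT (lam_int x).
Proof. by apply: measurable_fun_ifT => //; exact: measurable_fun_ltr. Qed.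

Definition intensity (x : R) (z : (R * R) * R) : R :=
  lam_int x (dist0 z.1) * exponential_pdf 1 z.2.

Lemma intensity_ge0 x z : 0 <= intensity x z.
Proof. by rewrite mulr_ge0 ?lam_int_ge0 ?exponential_pdf_ge0. Qed.

Lemma measurable_intensity x : measurable_fun setT (intensity x).
Proof.
apply: measurable_funM; last exact: (measurableT_comp (@measurable_exponential_pdf R 1)).
apply: (measurableT_comp (measurable_lam_int x)).
exact: (measurableT_comp measurable_dist0).
Qed.

(* Truncated at 0 because [esum] ignores the (almost surely absent) negative marks. *)
Definition received_power (x : R) (z : (R * R) * R) : R :=
  Num.max (z.2 * dist0 z.1 `^ (- alpha) * (if rho x <= dist0 z.1 then 1 else 0)) 0.

Lemma received_power_ge0 x z : 0 <= received_power x z.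
Proof. by rewrite /received_power le_max lexx orbT. Qed.

Let measurable_power2 x : measurable_fun setT (fun v : R * R =>
  Num.max (v.2 * v.1 `^ (- alpha) * (if rho x <= v.1 then 1 else 0)) 0).
Proof.
apply: measurable_maxr => //; apply: measurable_funM.
  by apply: measurable_funM => //; exact: (measurableT_comp (@measurable_powR R (- alpha))).
by apply: measurable_fun_ifT => //; exact: measurable_fun_ler.
Qed.

Lemma measurable_received_power x : measurable_fun setT (received_power x).
Proof.
apply: (measurableT_comp (measurable_power2 x) (g := fun z : (R * R) * R => (dist0 z.1, z.2))).
apply: measurable_fun_pair => //; exact: (measurableT_comp measurable_dist0).
Qed.

Lemma interfE x (Phi : set ((R * R) * R)) :
  interf alpha P N M mu_ x Phi = (\esum_(z in Phi) (received_power x z)%:E)%E.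
Proof. by rewrite /Defs.interf [LHS]esum_max0. Qed.

(** At distance [r] the mark integrates to [W r]. The intensity vanishes below [rho x], so the
    radial integral starts there and is the one of [integral_interference]. *)
Lemma integral_laplace_exponent (x s : R) : 0 < x -> 0 <= s ->
  (\int[((mu \x mu) \x mu)%E]_z ((1 - expR (- (s * received_power x z))) * intensity x z)%:E
   = (2 * pi * lamb * fine PAUE / (alpha - 2) * s * (rho x ^+ 2) `^ (1 - alpha / 2) *
      hyp2F1 1 (1 - 2 / alpha) (2 - 2 / alpha) (- s * (rho x ^+ 2) `^ (- (alpha / 2))))%:E)%E.
Proof.
move=> x0 s0.
have r0 := rho_gt0 alpha P N M mu_ x0.
pose u (v : R * R) := (1 - expR (- (s *
  Num.max (v.2 * v.1 `^ (- alpha) * (if rho x <= v.1 then 1 else 0)) 0))) *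
  (lam_int x v.1 * exponential_pdf 1 v.2).
pose W (r : R) := s * r `^ (- alpha) / (1 + s * r `^ (- alpha)).
pose V (r : R) := if r < rho x then 0 else lamb * fine PAUE * W r.
have W0 r : 0 <= W r by rewrite divr_ge0 ?addr_ge0 ?mulr_ge0 ?powR_ge0.
have V0 r : 0 <= V r by rewrite /V; case: ifP => // _; exact: mulr_ge0.
have msr : measurable_fun setT (fun r : R => s * r `^ (- alpha)) by exact: measurable_funM.
have mW : measurable_fun setT W.
  apply: measurable_funM => //; apply: (measurableT_comp measurable_invr).
  exact: measurable_funD.
have mV : measurable_fun setT V.
  apply: measurable_fun_ifT => //; first exact: measurable_fun_ltr.
  exact: measurable_funM.
have u0 v : 0 <= u v.
  rewrite mulr_ge0 ?mulr_ge0 ?lam_int_ge0 ?exponential_pdf_ge0// subr_ge0.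
  by rewrite -expR0 ler_expR oppr_le0 mulr_ge0// le_max lexx orbT.
have mu1 : measurable_fun setT u.
  apply: measurable_funM.
    apply: measurable_funB => //; apply: (measurableT_comp (@measurable_expR R)).
    by apply: measurableT_comp => //; apply: measurable_funM => //; exact: measurable_power2.
  apply: measurable_funM; last exact: (measurableT_comp (@measurable_exponential_pdf R 1)).
  exact: (measurableT_comp (measurable_lam_int x)).
have uV r : 0 <= r -> (\int[mu]_y (u (r, y))%:E = (V r)%:E)%E.
  move=> _; rewrite /u /V /Defs.lam_int/=; have [rr|rr] := ltP r (rho x).
    by rewrite integral0_eq// => y _; rewrite mul0r mulr0.
  have q0 : 0 <= s * r `^ (- alpha) by rewrite mulr_ge0// powR_ge0.
  rewrite EFinM /W -integral_laplace_exp_pdf// -ge0_integralZl_EFin//; last 2 first.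
  - move=> y _; rewrite lee_fin mulr_ge0 ?exponential_pdf_ge0// subr_ge0.
    by rewrite -expR0 ler_expR oppr_le0 le_max lexx orbT.
  - apply/measurable_EFinP; apply: measurable_funM; last exact: measurable_exponential_pdf.
    apply: measurable_funB => //; apply: (measurableT_comp (@measurable_expR R)).
    by apply: measurableT_comp => //; apply: measurable_maxr => //; exact: measurable_funM.
  apply: eq_integral => y _; rewrite -EFinM; congr EFin.
  have -> : s * maxr (y * r `^ (- alpha) * 1) 0 = maxr (s * r `^ (- alpha) * y) 0.
    by rewrite maxr_pMr// mulr0 mulr1 mulrCA mulrC.
  by ring.
transitivity (\int[((mu \x mu) \x mu)%E]_z (u (dist0 z.1, z.2))%:E)%E => //.
rewrite (integral_marked_radial mu1 u0 mV V0 uV).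
have -> : (\int[mu]_(r in `]0%R, +oo[) (r * V r)%:E =
    (lamb * fine PAUE)%:E * \int[mu]_(r in `[rho x, +oo[) (r * W r)%:E)%E.
  rewrite -ge0_integralZl_EFin//; last 2 first.
  - move=> r /=; rewrite in_itv/= andbT => rr; rewrite lee_fin mulr_ge0//.
    by rewrite (le_trans (ltW r0)).
  - by apply/measurable_EFinP; apply: measurable_funTS; exact: measurable_funM.
  rewrite integral_itv0y_if [RHS]integral_mkcond; apply: eq_integral => r _.
  rewrite patchE /V; have [rr|rr] := ltP r (rho x).
    rewrite memNset/=; last by rewrite in_itv/= andbT leNgt rr.
    by rewrite mulr0; case: ifP.
  rewrite mem_set/=; last by rewrite in_itv/= rr.
  by rewrite (lt_le_trans r0 rr) -EFinM; congr EFin; ring.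
rewrite integral_interference// -!EFinM; congr EFin.
by field; rewrite subr_eq0 gt_eqF.
Qed.

(** These balls are the exhausting sets for [laplace_functional]. The marks have total mass 1 and
    the spatial intensity is bounded by [lamb * fine PAUE], so the area of the disc controls the
    mass. *)
Lemma Lam_ball_lty x (n : nat) : (Lam x [set z | (dist0 z.1 < n%:R)%R] < +oo)%E.
Proof.
rewrite /Defs.Lam -integral_if.
pose u (v : R * R) := if v.1 < n%:R then lam_int x v.1 * exponential_pdf 1 v.2 else 0.
pose V (r : R) := if r < n%:R then lam_int x r else 0.
have u0 v : 0 <= u v.
  by rewrite /u; case: ifP => // _; rewrite mulr_ge0 ?lam_int_ge0 ?exponential_pdf_ge0.
have V0 r : 0 <= V r by rewrite /V; case: ifP => // _; exact: lam_int_ge0.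
have mV : measurable_fun setT V.
  by apply: measurable_fun_ifT => //; [exact: measurable_fun_ltr|exact: measurable_lam_int].
have mu1 : measurable_fun setT u.
  apply: measurable_fun_ifT => //; first exact: measurable_fun_ltr.
  apply: measurable_funM; last exact: (measurableT_comp (@measurable_exponential_pdf R 1)).
  exact: (measurableT_comp (measurable_lam_int x)).
have uV r : 0 <= r -> (\int[mu]_y (u (r, y))%:E = (V r)%:E)%E.
  move=> _; rewrite /u /V/=; case: ifP => _; last by rewrite integral0.
  under eq_integral do rewrite EFinM.
  rewrite ge0_integralZl_EFin//; last 3 first.
  - by move=> y _; rewrite lee_fin exponential_pdf_ge0.
  - by apply/measurable_EFinP; exact: measurable_exponential_pdf.
  - exact: lam_int_ge0.
  by rewrite integral_exponential_pdf// mule1.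
rewrite (_ : (\int[_]_z _)%E = (\int[((mu \x mu) \x mu)%E]_z (u (dist0 z.1, z.2))%:E)%E); last first.
  by apply: eq_integral => z _; rewrite /u/=; case: ifP.
rewrite (integral_marked_radial mu1 u0 mV V0 uV).
apply: (@le_lt_trans _ _ ((2 * pi)%:E * ((lamb * fine PAUE)%:E *
   \int[mu]_(r in `]0%R, n%:R[) r%:E))%E); last first.
  by rewrite integral0_id// -!EFinM ltry.
apply: lee_wpmul2l; first by rewrite lee_fin mulr_ge0// pi_ge0.
rewrite -ge0_integralZl_EFin//; last by move=> r /=; rewrite in_itv/= => /andP[r0 _]; rewrite lee_fin ltW.
have -> : (\int[mu]_(r in `]0%R, n%:R[) ((lamb * fine PAUE)%:E * r%:E) =
    \int[mu]_r (if (0 < r)%R && (r < n%:R)%R then (lamb * fine PAUE * r)%:E else 0))%E.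
  by rewrite integral_if; congr (integral _ _ _).
rewrite integral_itv0y_if; apply: ge0_le_integral => //.
- move=> r _; case: ifP => // r0; rewrite lee_fin mulr_ge0//; exact: ltW.
- apply: measurable_fun_ifT => //; first exact: measurable_fun_ltr.
  by apply/measurable_EFinP; exact: measurable_funM.
- apply: measurable_fun_ifT => //.
    by apply: measurable_and; exact: measurable_fun_ltr.
  by apply/measurable_EFinP; exact: (@measurable_funM _ _ R).
move=> r _; have [r0|//] := ltP 0 r; rewrite /V /=.
have [rn|rn] := ltP r n%:R; last by rewrite mulr0.
rewrite lee_fin mulrC ler_wpM2r ?(ltW r0)//.
by rewrite /Defs.lam_int; case: ifP.
Qed.

Section conditional_rate.
Context d (Om : measurableType d) (Pr : probability Om R) (h : Om -> R)
  (Phi : Om -> set ((R * R) * R)) (x : R).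
Hypotheses (x0 : 0 < x) (mh : measurable_fun [set: Om] h)
  (hlaw : forall B : set R, measurable B ->
     Pr (h @^-1` B) = (\int[mu]_(t in B) (exponential_pdf 1 t)%:E)%E)
  (ppp : is_PPP Pr Phi (Lam x))
  (indep : forall (B : set R) n (A : 'I_n -> set ((R * R) * R)) (k : 'I_n -> nat),
    measurable B -> (forall i, measurable (A i)) -> (forall i, (Lam x (A i) < +oo)%E) ->
    Pr (h @^-1` B `&`
        \bigcap_(i in [set: 'I_n]) [set w | @count_pts R _ (Phi w) (A i) = ((k i)%:R)%:E])
    = (Pr (h @^-1` B) *
       Pr (\bigcap_(i in [set: 'I_n]) [set w | @count_pts R _ (Phi w) (A i) = ((k i)%:R)%:E]))%E).

Lemma conditional_rate :
  (\int[Pr]_w (ln (1 + sinr alpha P N M mu_ x (h w) (Phi w)))%:E =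
   rate_given lamb alpha P N M mu_ x)%E.
Proof.
have xa0 : 0 < x `^ alpha by rewrite powR_gt0.
have NP0 : 0 < N / P by rewrite divr_gt0.
pose J w := (\esum_(z in Phi w) (received_power x z)%:E)%E.
have joint (t : R) n (A : 'I_n -> set ((R * R) * R)) (j : 'I_n -> nat) : 0 <= t ->
    (forall i, measurable (A i)) -> (forall i, (Lam x (A i) < +oo)%E) ->
    (forall i i', i != i' -> A i `&` A i' = set0) ->
    Pr ([set w | t <= h w] `&`
      \bigcap_(i in [set: 'I_n]) [set w | @count_pts R _ (Phi w) (A i) = (j i)%:R%:E]) =
    (expR (- t) * \prod_(i < n) pois_pmf (fine (Lam x (A i))) (j i))%:E.
  move=> t0 mA LA dA.
  have -> : [set w | t <= h w] = h @^-1` `[t, +oo[%classic.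
    by apply/seteqP; split => w /=; rewrite in_itv/= andbT.
  rewrite indep// hlaw//.
  rewrite integral_exponential_pdf_tail// (ppp.2 n A j mA LA dA).
  by rewrite prodEFin -EFinM.
have main (s b : R) : 0 < s -> 0 <= b -> measurable_fun setT J /\
    Pr [set w | (J w <= (h w / s - b)%:E)%E] = (expR (- (s * b)) * LI s x)%:E.
  move=> s0 b0.
  pose B n := [set z : (R * R) * R | dist0 z.1 < n%:R].
  have mB n : measurable (B n).
    by apply: measurable_set_ltr; exact: (measurableT_comp measurable_dist0).
  have ndB : nondecreasing_seq B.
    move=> n m nm; apply/subsetPset => z /= /lt_le_trans; apply.
    by rewrite ler_nat.
  have UB : \bigcup_n B n = setT.
    apply/seteqP; split => // z _; exists (truncn (dist0 z.1)).+1 => //=.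
    exact: truncnS_gt.
  have [mJ PJ] := @laplace_functional R _ Om Pr _ _ ((mu \x mu) \x mu)%E
    (intensity x) h Phi (measurable_intensity x) (intensity_ge0 x) mh ppp.1 joint _ _ _ _ _
    (measurable_received_power x) (received_power_ge0 x) mB (Lam_ball_lty x) ndB UB s0 b0
    (integral_laplace_exponent x0 (ltW s0)).
  by split => //; rewrite PJ opprD expRD.
have J0 w : (0 <= J w)%E by apply: esum_ge0 => z _; rewrite lee_fin received_power_ge0.
have hneg : Pr [set w | h w < 0] = 0%E.
  have -> : [set w | h w < 0] = h @^-1` `]-oo, 0[%classic.
    by apply/seteqP; split => w /=; rewrite in_itv.
  rewrite hlaw// integral0_eq// => t /=; rewrite in_itv/= => t0.
  by rewrite lt0_exponential_pdf.
(* Measurability of [J] involves neither [s] nor [b]; any admissible pair yields it. *)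
have [mJ _] := main 1 0 ltr01 (lexx 0).
transitivity (\int[Pr]_w (ln (1 + (if J w \is a fin_num then
    h w * (x `^ alpha)^-1 / (fine (J w) + N / P) else 0)))%:E)%E.
  by apply: eq_integral => w _; rewrite /sinr interfE powRN.
rewrite expectation_rate// /rate_given; apply: eq_integral => t /set_mem/=.
rewrite in_itv/= andbT => t0.
have s0 : 0 < x `^ alpha * (expR t - 1) by rewrite mulr_gt0// subr_gt0 -expR0 ltr_expR.
have [_ ->] := main _ _ s0 (ltW NP0).
by rewrite /rate_integrand; congr (expR (- _) * _)%:E; ring.
Qed.

End conditional_rate.
End interference.

Theorem theorem2 (R : realType) (lamb alpha P N M mu_ : R)
  (hlamb : 0 < lamb) (halpha : 2 < alpha) (hP : 0 < P) (hN : 0 < N)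
  (hM : 1 <= M) (hmu : 1 <= mu_ <= 2)
  (d : measure_display) (Om : R -> measurableType d)
  (Pr : forall x : R, probability (Om x) R)
  (h11 : forall x : R, Om x -> R)
  (Phi : forall x : R, Om x -> set ((R * R) * R)) :
  (* conditionally on X11 = x (x > 0): h11 ~ Exp(1), Phi is a marked PPP
     (positions: intensity lam_int x at distance r; marks: i.i.d. Exp(1)),
     and h11 is independent of Phi *)
  (forall x : R, 0 < x ->
     measurable_fun [set: Om x] (h11 x) /\
     (forall B : set R, measurable B ->
        Pr x (h11 x @^-1` B) = (\int[@lebesgue_measure R]_(t in B) (exponential_pdf 1 t)%:E)%E) /\
     is_PPP (Pr x) (Phi x) (Lam lamb alpha P N M mu_ x) /\
     (forall (B : set R) n (A : 'I_n -> set ((R * R) * R)) (k : 'I_n -> nat),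
        measurable B -> (forall i, measurable (A i)) ->
        (forall i, (Lam lamb alpha P N M mu_ x (A i) < +oo)%E) ->
        Pr x (h11 x @^-1` B `&`
              \bigcap_(i in [set: 'I_n]) [set w | @count_pts R _ (Phi x w) (A i) = ((k i)%:R)%:E])
        = (Pr x (h11 x @^-1` B) *
           Pr x (\bigcap_(i in [set: 'I_n]) [set w | @count_pts R _ (Phi x w) (A i) = ((k i)%:R)%:E]))%E)) ->
  let PA := PAUE lamb alpha P N M mu_ in
  let rho := rho alpha P N M mu_ in
  (* E[ln(1 + SINR) | X11 = x] *)
  let G := fun x : R =>
    (\int[Pr x]_w (ln (1 + sinr alpha P N M mu_ x (h11 x w) (Phi x w)))%:E)%E in
  (* R_SE = E[ln(1+SINR)] with X11 distributed according to its law given A_UE *)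
  let RSE :=
    ((\int[(@lebesgue_measure R) \x (@lebesgue_measure R)]_(z in AUE alpha P N M mu_)
        ((joint_density lamb z)%:E * G z.1)) * ((fine PA)^-1)%:E)%E in
  RSE =
    (((2 * pi * lamb) / fine PA)%:E *
     \int[@lebesgue_measure R]_(x in `]0%R, +oo[)
        ((x * expR (- (pi * lamb * rho x ^+ 2)))%:E *
         \int[@lebesgue_measure R]_(tau in `]0%R, +oo[)
            (expR (- (N / P * x `^ alpha * (expR tau - 1))) *
             LI lamb alpha P N M mu_ (x `^ alpha * (expR tau - 1)) x)%:E))%E
  /\
  PA = (\int[@lebesgue_measure R]_(y in `]0%R, +oo[)
          (2 * (pi * lamb) ^+ 2 * y * expR (- (pi * lamb * y ^+ 2)) *
           (Num.min y (thr alpha P N M mu_ y)) ^+ 2)%:E)%E.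
Proof.
move=> H PA rho' G RSE; split; last exact: PAUE_integral.
rewrite /RSE (integral_joint_rate hlamb halpha hP hN hM hmu); last first.
  move=> x x0; have [mh [hlaw [ppp indep]]] := H x x0.
  exact: conditional_rate.
by rewrite muleAC -EFinM.
Qed.
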